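(* For $t\ge0$, the covariance $c_{A,S}(t):=\mathrm{Cov}(A(t),S(t))$ between the cumulative arrival process and the cumulative potential service process is given by $$c_{A,S}(t)=2\,\frac{\mathrm{Cov}(\Lambda,\mathcal{M})}{\mathbb{E}\xi}\left(\int_0^t\big(tu-\tfrac12u^2\big)\,\mathbb{P}(\xi>u)\,\mathrm{d}u+\tfrac12t^2\int_t^\infty\mathbb{P}(\xi>u)\,\mathrm{d}u\right).$$
   Context: Rates are resampled at the epochs of a stationary renewal process: the inter-sample intervals are i.i.d., distributed as a non-negative random variable $\xi$ with a density and with $\mathbb{E}\xi<\infty$, $\mathbb{E}[\xi^2]<\infty$, except that the time from $0$ until the first resampling is independent of the others and has the residual lifetime distribution with density $x\mapsto\mathbb{P}(\xi>x)/\mathbb{E}\xi$. At time $0$ and at each resampling epoch a new pair (arrival rate, service rate) is drawn; these pairs are i.i.d., independent of the resampling epochs, and distributed as a componentwise non-negative random vector $(\Lambda,\mathcal{M})$ (components possibly dependent, arbitrary distribution) with $\mathrm{Var}\,\Lambda<\infty$ and $\mathrm{Var}\,\mathcal{M}<\infty$. Let $\Lambda(t)$ and $\mathcal{M}(t)$ be the arrival rate and service rate that apply at time $t$. Conditionally on $(\Lambda(s),\mathcal{M}(s))_{s\ge0}$, the cumulative arrival process $A(\cdot)$ and the cumulative potential service process $S(\cdot)$ are independent (inhomogeneous) Poisson processes with intensities $\Lambda(\cdot)$ and $\mathcal{M}(\cdot)$, respectively; in particular $A(t)$ is Poisson with (random) parameter $\int_0^t\Lambda(s)\,\mathrm{d}s$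 and $S(t)$ is Poisson with (random) parameter $\int_0^t\mathcal{M}(s)\,\mathrm{d}s$. *)

(* Defs.v *)
From HB Require Import structures.
From mathcomp Require Import all_boot all_order all_algebra finmap.
From mathcomp Require Import all_classical all_reals all_analysis.

Set Implicit Arguments.
Unset Strict Implicit.
Unset Printing Implicit Defensive.

Import Order.TTheory GRing.Theory Num.Theory.
Import numFieldNormedType.Exports.

Local Open Scope classical_set_scope.
Local Open Scope ring_scope.

Section general_probability.
Context d (T : measurableType d) (R : realType) (P : probability T R).

Definition identically_distributed d' (U : measurableType d') (X Y : T -> U) :=
  forall B : set U, measurable B -> P (X @^-1` B) = P (Y @^-1` B).

Definition has_density (X : T -> R) (f : R -> R) :=
  [/\ measurable_fun setT f, forall x, 0 <= f x &
    forall B : set R, measurable B ->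
      P (X @^-1` B) = (\int[lebesgue_measure]_(x in B) (f x)%:E)%E].

Definition mutually_independent (I : choiceType) (F : I -> set (set T)) :=
  forall (J : {fset I}) (E : I -> set T), (forall i, i \in J -> F i (E i)) ->
    P (\bigcap_(i in [set` J]) E i) = (\prod_(i <- J) P (E i))%E.

(* [p] is almost surely equal to the conditional probability of [E] given the
   sigma-algebra [F].  That [p] is [F]-measurable up to a null set is not part
   of the definition: below it is only used for functionals of the processes
   which generate [F]. *)
Definition is_conditional_probability (F : set (set T)) (E : set T)
    (p : T -> \bar R) :=
  forall G, F G -> P (E `&` G) = (\int[P]_(w in G) p w)%E.

Definition counting_process (N : R -> T -> nat) :=
  {ae P, forall w, [/\ N 0 w = 0%N,
    forall s u, 0 <= s -> s <= u -> (N s w <= N u w)%N &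
    forall s, 0 <= s -> \forall u \near s^'+, N u w = N s w]}.

Definition generated_sigma_algebra (X Y : R -> T -> R) : set (set T) :=
  <<s \bigcup_(s in `[0, +oo[)
    (preimage_set_system setT (X s) measurable `|`
     preimage_set_system setT (Y s) measurable) >>.

Definition increments_are (N : R -> T -> nat) (k : nat) (s : nat -> R)
    (a : nat -> nat) : set T :=
  [set w | forall i, (i < k)%N -> N (s i.+1) w = (N (s i) w + a i)%N].

(* The second argument of [poisson_prob] is a dummy.  [poisson_prob] is used
   rather than [poisson_pmf] because only the former is correct at rate 0. *)
Definition poisson_increments (lam : R -> T -> R) (k : nat) (s : nat -> R)
    (a : nat -> nat) (w : T) : \bar R :=
  (\prod_(i < k)
    poisson_prob (\int[lebesgue_measure]_(u in `[s i, s i.+1]) lam u w)%R 0%N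
      [set a i])%E.

(* Conditionally on the pair of processes (lam, mu), the processes A and S are
   independent Poisson processes with intensities lam and mu: given (lam, mu),
   the increments of A and of S over the successive intervals of any finite
   subdivision of [0, +oo[ are independent and Poisson distributed, with the
   integrals of lam and mu as parameters. *)
Definition conditionally_independent_poisson (lam mu : R -> T -> R)
    (A S : R -> T -> nat) :=
  [/\ counting_process A, counting_process S &
    forall (k : nat) (s : nat -> R) (a b : nat -> nat),
      0 <= s 0%N -> (forall i, (i < k)%N -> s i <= s i.+1) ->
      is_conditional_probability (generated_sigma_algebra lam mu)
        (increments_are A k s a `&` increments_are S k s b)
        (fun w => poisson_increments lam k s a w *
                  poisson_increments mu k s b w)%E].

End general_probability.

Section resampling.
Context d (T : measurableType d) (R : realType).

(* [tau 0] is the time from 0 until the first resampling, and [tau n.+1] is the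
   time between the resamplings number [n] and [n.+1] (counted from 0). *)
Definition resampling_epoch (tau : nat -> T -> R) (n : nat) (w : T) : R :=
  \sum_(i < n.+1) tau i w.

(* The default value 0 is used only if all the epochs are at most [t]; for
   i.i.d. positive inter-sample times this has probability zero. *)
Definition resampling_count (tau : nat -> T -> R) (t : R) (w : T) : nat :=
  xget 0%N [set n | t < resampling_epoch tau n w /\
                    forall m, (m < n)%N -> resampling_epoch tau m w <= t].

(* [Z 0] is drawn at time 0 and [Z n.+1] at the epoch [n]. *)
Definition current_rates (tau : nat -> T -> R) (Z : nat -> T -> R * R)
    (t : R) (w : T) : R * R :=
  Z (resampling_count tau t w) w.

Definition intervals_and_rates (tau : nat -> T -> R) (Z : nat -> T -> R * R)
    (i : nat + nat) : set (set T) :=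
  match i with
  | inl n => preimage_set_system setT (tau n) measurable
  | inr n => preimage_set_system setT (Z n) measurable
  end.

End resampling.

Definition residual_density d (T : measurableType d) (R : realType)
    (P : probability T R) (xi : {RV P >-> R}) (x : R) : R :=
  if 0 <= x then fine (ccdf xi x) / fine 'E_P[xi] else 0.

(* Main.v *)
(* Almost surely the cumulated rates up to t are X = sum_n Lambda_n l_n and
   Y = sum_n M_n l_n, where l_n is the length of the part of [0, t] covered by
   the n-th interval between resamplings.  The lengths are independent of the
   rates and sum to t, so E[X Y] = t^2 E[Lambda] E[M] + Cov(Lambda, M) W with
   W = sum_n E[l_n^2], and the moments of the mixed Poisson variables A(t) and
   S(t) reduce to those of X and Y: the covariance is Cov(Lambda, M) W.
   To compute W, let T_n = tau_0 + U_n be the resampling epochs, U_n being a sum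
   of n copies of xi.  Integrating the residual density over tau_0 shows that
   E[phi(T_n)] is 1/E[xi] times the expected integral of phi over
   [U_n, U_(n+1)[, and these intervals tile [0, +oo[; hence sum_n E[phi(T_n)] is
   the integral of phi over [0, +oo[ divided by E[xi].  With
   phi(x) = E[min(xi, (t - x)^+)^2] this gives all the terms of W but the first,
   which only involves tau_0. *)
Require Import Defs.
From HB Require Import structures.
From mathcomp Require Import all_boot all_order all_algebra finmap.
From mathcomp Require Import all_classical all_reals all_analysis.
From mathcomp Require Import measurable_realfun ring lra zify.

Set Implicit Arguments.
Unset Strict Implicit.
Unset Printing Implicit Defensive.

Import Order.TTheory GRing.Theory Num.Theory.
Import numFieldNormedType.Exports.

Local Open Scope classical_set_scope.
Local Open Scope ring_scope.

(** * Independence of blocks of sigma-algebras *)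

Section independence.
Context d (T : measurableType d) (R : realType) (P : probability T R).

(** Sums, integrals and expectations are exchanged for nonnegative functions in the extended reals,
    so that integrability only matters once values are known. Intervals and rates are nonnegative
    only almost surely, hence the computation runs on their positive parts, equal to them off a null
    set. No moment E[l_i l_j] with i different from j is computed. The moments E[Lambda_i M_j] take
    one value on the diagonal and another off it, so E[X Y] only involves the full double sum of the
    E[l_i l_j] and its diagonal; the double sum comes from the same statement at constant rates 1,
    where X = Y = t. In the renewal step, the P(xi > x) of the residual density is read as the
    probability that tau_(n+1) exceeds x, with the [n] of U_n itself: this choice makes the
    resulting intervals adjacent. Measurability in [w] of the path integrals of the rates is not
    established. Measurable substitutes X and Y are built as limits of sums and agree with them
    almost surely, which suffices because an integral of a nonnegative function is insensitive to
    null sets even without measurability. *)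

Lemma g_sigma_algebra_indep (G : set (set T)) (B : set T) :
    measurable B -> G `<=` measurable -> setI_closed G ->
    (forall A, G A -> P (A `&` B) = (P A * P B)%E) ->
  forall A, <<s G >> A -> P (A `&` B) = (P A * P B)%E.
Proof.
move=> mB mG GI indep A; rewrite -setI_closed_g_dynkin_g_sigma_algebra//.
(* Dynkin argument: the measurable sets independent of [B] form a Dynkin system. Measurability is
   carried along because complements and disjoint unions are handled through their measures. *)
suff: <<d G>> `<=` [set A | measurable A /\ P (A `&` B) = (P A * P B)%E].
  by move=> /[apply] -[].
apply: smallest_sub; last by move=> C GC; split; [exact: mG|exact: indep].
split.
- by split=> //; rewrite setTI probability_setT mul1e.
- move=> C [mC CB]; split; first exact: measurableC.
  have -> : ~` C `&` B = B `\` (C `&` B).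
    by rewrite setIC setDIr setDv setU0 setDE.
  have mCB : measurable (C `&` B) by exact: measurableI.
  transitivity (P B - P (C `&` B))%E.
    rewrite measureD//; last by rewrite -ge0_fin_numE ?fin_num_measure.
    by rewrite (_ : B `&` (C `&` B) = C `&` B)// setICA setIid.
  rewrite CB probability_setC//.
  by rewrite muleBl ?fin_num_measure ?mul1e.
- move=> F tF HF; split; first by apply: bigcup_measurable => k _; case: (HF k).
  have mF k : measurable (F k) by case: (HF k).
  rewrite setI_bigcupl measure_bigcup//; last 2 first.
    by move=> k _; exact: measurableI.
    by apply: trivIset_setIr.
  rewrite measure_bigcup//.
  rewrite muleC -[P B]fineK ?fin_num_measure// -nneseriesZl//.
  by apply: eq_eseriesr => k _; rewrite fineK ?fin_num_measure// muleC; case: (HF k).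
Qed.

Section blocks.
Variables (I : choiceType) (F : I -> set (set T)).
Hypotheses (mF : forall i, F i `<=` measurable) (FI : forall i, setI_closed (F i))
  (FT : forall i, F i setT) (indepF : mutually_independent P F).

(** The pi-system of cylinders that generates the join of the [F i] for [i] in [J]. The condition on
    [A i] outside [J] is harmless, since every [F i] contains [setT]. *)
Definition block (J : {fset I}) : set (set T) :=
  [set E | exists2 A : I -> set T, forall i, F i (A i) &
                                   E = \bigcap_(i in [set` J]) A i].

Lemma block_measurable J : block J `<=` measurable.
Proof.
move=> _ [A FA ->]; apply: fin_bigcap_measurable => // i _.
exact/mF/FA.
Qed.

Lemma block_setI_closed J : setI_closed (block J).
Proof.
move=> _ _ [A FA ->] [B FB ->]; exists (fun i => A i `&` B i).
  by move=> i; exact: FI.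
by rewrite bigcapI.
Qed.

Lemma block_indep J K : [disjoint J & K]%fset -> forall A B,
  block J A -> block K B -> P (A `&` B) = (P A * P B)%E.
Proof.
move=> JK _ _ [A FA ->] [B FB ->].
pose C i := if i \in J then A i else B i.
have KJ i : i \in K -> i \notin J.
  by apply: contraTN => iJ; move/fdisjointP : JK; exact.
have -> : \bigcap_(i in [set` J]) A i `&` \bigcap_(i in [set` K]) B i =
    \bigcap_(i in [set` (J `|` K)%fset]) C i.
  rewrite set_fsetU bigcap_setU; congr (_ `&` _).
    by apply: eq_bigcapr => i /= iJ; rewrite /C iJ.
  by apply: eq_bigcapr => i /= iK; rewrite /C (negbTE (KJ _ iK)).
have FC i : F i (C i) by rewrite /C; case: ifP.
rewrite !indepF//.
(* As [J] and [K] are disjoint, concatenating their enumerations enumerates the union without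
   repetition, so the product splits. *)
rewrite (perm_big (enum_fset J ++ enum_fset K)); last first.
  apply: uniq_perm; rewrite ?fset_uniq//.
    rewrite cat_uniq !fset_uniq andbT/=; apply/hasPn => i iK.
    exact: KJ.
  by move=> i; rewrite in_fsetU mem_cat.
rewrite big_cat/=; congr (_ * _)%E; apply: eq_big_seq => i.
  by move=> iJ; rewrite /C iJ.
by move=> /KJ/negbTE; rewrite /C => ->.
Qed.

(** The Dynkin argument is applied to one side at a time: on the [J] side against a fixed [B], then
    on the [K] side against a cylinder of [J]. *)
Lemma g_block_indep J K : [disjoint J & K]%fset -> forall A B,
  <<s block J>> A -> <<s block K>> B -> P (A `&` B) = (P A * P B)%E.
Proof.
move=> JK A B JA KB.
have gm L : <<s block L>> `<=` measurable.
  apply: smallest_sub; last exact: block_measurable.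
  exact: sigma_algebra_measurable.
apply: (g_sigma_algebra_indep (G := block J)) => //.
- exact: gm KB.
- exact: block_measurable.
- exact: block_setI_closed.
- move=> A' JA'; rewrite setIC muleC.
  apply: (g_sigma_algebra_indep (G := block K)) => //.
  + exact: block_measurable JA'.
  + exact: block_measurable.
  + exact: block_setI_closed.
  + by move=> B' KB'; rewrite setIC muleC (block_indep JK).
Qed.

(** The same points [T] with a smaller sigma-algebra: to depend only on the coordinates in [J]
    becomes a measurability statement, stable under sums, minima and products. *)
Definition blockType (J : {fset I}) := g_sigma_algebraType (block J).

Lemma block_measurable_fun d' (U : measurableType d') J (f : T -> U) :
  measurable_fun setT (f : blockType J -> U) -> measurable_fun setT f.
Proof.
move=> mf _ B mB; have := mf measurableT _ mB.
apply: smallest_sub; last exact: block_measurable.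
exact: sigma_algebra_measurable.
Qed.

Lemma coordinate_block d' (U : measurableType d') J i (f : T -> U) : i \in J ->
  (forall B, measurable B -> F i (f @^-1` B)) ->
  measurable_fun setT (f : blockType J -> U).
Proof.
move=> iJ Ff _ B mB; rewrite setTI; apply: sub_sigma_algebra.
exists (fun j => if j == i then f @^-1` B else setT).
  by move=> j; case: eqP => // ->; exact: Ff.
apply/seteqP; split => x /=; first by move=> Bx j _; case: ifP.
by move=> /(_ i iJ); rewrite eqxx.
Qed.

End blocks.

(** The joint law agrees with the product law on rectangles, hence everywhere, and Tonelli applies.
    The second variable [v], over the same space, plays the part of an independent copy. *)
Lemma integral_indep2 d1 d2 (U : measurableType d1) (V : measurableType d2)
    (X : T -> U) (Y : T -> V) (f : U * V -> \bar R) :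
    measurable_fun setT X -> measurable_fun setT Y ->
    (forall A B, measurable A -> measurable B ->
       P (X @^-1` A `&` Y @^-1` B) = (P (X @^-1` A) * P (Y @^-1` B))%E) ->
    measurable_fun [set: U * V] f -> (forall z, 0 <= f z)%E ->
  (\int[P]_w f (X w, Y w) = \int[P]_w \int[P]_v f (X w, Y v))%E.
Proof.
move=> mX mY XY mf f0.
pose X' : {mfun T >-> U} := mfun_Sub (mem_set mX).
pose Y' : {mfun T >-> V} := mfun_Sub (mem_set mY).
have mXY : measurable_fun setT (fun w => (X w, Y w)) by exact: measurable_fun_pair.
pose XY' : {mfun T >-> (U * V)%type} := mfun_Sub (mem_set mXY).
transitivity (\int[distribution P XY']_z f z)%E.
  by rewrite ge0_integral_distribution.
transitivity (\int[distribution P X' \x distribution P Y']_z f z)%E.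
  apply: eq_measure_integral => A mA _; apply/esym/product_measure_unique => //.
rewrite fubini_tonelli1// ge0_integral_distribution//; last 2 first.
  exact: measurable_fun_fubini_tonelli_F.
  by move=> x; exact: integral_ge0.
apply: eq_integral => w _ /=.
rewrite /fubini_F ge0_integral_distribution//.
exact: measurableT_comp.
Qed.

Lemma identically_distributed_integral d' (U : measurableType d') (X Y : T -> U)
    (f : U -> \bar R) :
    measurable_fun setT X -> measurable_fun setT Y ->
    identically_distributed P X Y -> measurable_fun setT f ->
    (forall x, 0 <= f x)%E ->
  (\int[P]_w f (X w) = \int[P]_w f (Y w))%E.
Proof.
move=> mX mY XY mf f0.
pose X' : {mfun T >-> U} := mfun_Sub (mem_set mX).
pose Y' : {mfun T >-> U} := mfun_Sub (mem_set mY).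
rewrite -[LHS](ge0_integral_distribution (P := P) X')//.
rewrite -[RHS](ge0_integral_distribution (P := P) Y')//.
apply: eq_measure_integral => A mA _; exact: (XY A mA).
Qed.

(** The law of [X] is dominated by [mu]; its Radon-Nikodym derivative and [g] have the same
    integrals over measurable sets, so they agree almost everywhere. *)
Lemma density_integral d' (U : measurableType d')
    (mu : {sigma_finite_measure set U -> \bar R})
    (X : T -> U) (g : U -> R) (phi : U -> \bar R) :
    measurable_fun setT X -> measurable_fun setT g ->
    (forall B, measurable B ->
      P (X @^-1` B) = (\int[mu]_(x in B) (g x)%:E)%E) ->
    measurable_fun setT phi -> (forall x, 0 <= phi x)%E ->
  (\int[P]_w phi (X w) = \int[mu]_x (phi x * (g x)%:E))%E.
Proof.
move=> mX mg XE mphi phi0.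
pose X' : {mfun T >-> U} := mfun_Sub (mem_set mX).
have mlg D : measurable D -> measurable_fun D (EFin \o g).
  by move=> mD; apply: measurable_funTS; exact/measurable_EFinP.
pose nu : {finite_measure set U -> \bar R} := distribution P X'.
have dom : nu `<< mu.
  apply/null_content_dominatesP => A mA A0.
  by rewrite [LHS](XE _ mA) null_set_integral//; exact: mlg.
transitivity (\int[nu]_x phi x)%E.
  by rewrite ge0_integral_distribution.
rewrite -(Radon_Nikodym_SigmaFinite.change_of_variables dom)//.
have intf := Radon_Nikodym_SigmaFinite.f_integrable dom.
have mf := measurable_int _ intf.
apply: ae_eq_integral => //.
- exact: emeasurable_funM.
- exact: emeasurable_funM (mlg _ _).
- apply: ae_eqe_mul2l; apply: integral_ae_eq => //; first exact: mlg.
  by move=> E _ mE; rewrite -Radon_Nikodym_SigmaFinite.f_integral//; exact: XE.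
Qed.

End independence.

(** * Lebesgue integrals *)

Section lebesgue_tonelli.
Context d (T : measurableType d) (R : realType).
Variables (P : {sigma_finite_measure set T -> \bar R}) (f : T * R -> \bar R).
Hypotheses (mf : measurable_fun [set: T * R] f) (f0 : forall z, (0 <= f z)%E).

Lemma lebesgue_tonelli : (\int[P]_w \int[lebesgue_measure]_x f (w, x) =
  \int[lebesgue_measure]_x \int[P]_w f (w, x))%E.
Proof.
exact: (@fubini_tonelli _ _ T (measurableTypeR R) R P (@lebesgue_measure R)).
Qed.

Lemma measurable_lebesgue_section :
  measurable_fun [set: T] (fun w => \int[lebesgue_measure]_x f (w, x))%E.
Proof.
exact: (@measurable_fun_fubini_tonelli_F _ _ T (measurableTypeR R) R
  (@lebesgue_measure R)).
Qed.

End lebesgue_tonelli.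

Section lebesgue_facts.
Context (R : realType).
Implicit Types (phi : R -> \bar R) (u a : R).

Lemma has_density_integral d (T : measurableType d) (P : probability T R)
    (X : T -> R) (g : R -> R) phi :
    measurable_fun setT X -> has_density P X g ->
    measurable_fun setT phi -> (forall x, 0 <= phi x)%E ->
  (\int[P]_w phi (X w) = \int[lebesgue_measure]_x (phi x * (g x)%:E))%E.
Proof.
move=> mX [mg _ XE] mphi phi0.
exact: (@density_integral _ _ _ P _ (measurableTypeR R) (@lebesgue_measure R)).
Qed.

(** The translate of Lebesgue measure gives intervals their length, which characterizes Lebesgue
    measure. *)
Lemma lebesgue_integral_shift phi u :
    measurable_fun setT phi -> (forall x, 0 <= phi x)%E ->
  (\int[lebesgue_measure]_x phi (x + u)%R = \int[lebesgue_measure]_x phi x)%E.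
Proof.
move=> mphi phi0.
have msh : @measurable_fun _ _ (measurableTypeR R) (measurableTypeR R) setT (fun x : R => x + u).
  exact: (@measurable_funD _ R R setT (fun x : R => x) (fun=> u)).
pose sh (x : measurableTypeR R) : measurableTypeR R := (x + u)%R.
transitivity (\int[pushforward (@lebesgue_measure R) sh]_x phi x)%E.
  by rewrite ge0_integral_pushforward.
apply: eq_measure_integral => A mA _; apply/esym/lebesgue_measure_unique => //.
move=> _ [[a b]] _ <-.
rewrite /= /pushforward (_ : sh @^-1` _ = `](a - u)%R, (b - u)%R]%classic).
  rewrite !lebesgue_measure_itv/= !lte_fin ltrD2r -!EFinD.
  by rewrite opprD opprK addrACA addNr addr0.
by apply/seteqP; split => x/=; rewrite !in_itv/= /sh ltrBlDr lerBrDr.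
Qed.

(** Used to replace the square of a length by an integral over levels, so that the tail of [xi]
    appears once the expectation is taken inside. *)
Lemma integral_2x a : 0 <= a ->
  (\int[lebesgue_measure]_(x in `[0%R, a[) (2 * x)%:E = (a ^+ 2)%:E)%E.
Proof.
rewrite le_eqVlt => /predU1P[<-|a0].
  by rewrite set_itvco0 integral_set0 expr0n.
rewrite integral_itv_bndo_bndc; last first.
  by apply/measurable_EFinP/measurable_funM => //; exact: measurable_cst.
have dF (x : R) : is_derive x (1 : R) (fun y : R => y ^+ 2) (2 * x).

  by apply: is_derive_eq; rewrite /GRing.scale/= mulr1 mulr_natl mulr2n.
rewrite (@continuous_FTC2 _ _ (fun x : R => x ^+ 2))//.
- by rewrite expr0n/= sube0.
- apply: continuous_subspaceT => x; apply: cvgM; first exact: cvg_cst.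
  exact: cvg_id.
- split.
  + by move=> x _; exact: ex_derive.
  + apply: cvg_at_right_filter; exact: exprn_continuous.
  + apply: cvg_at_left_filter; exact: exprn_continuous.
- by move=> x _; rewrite derive1E derive_val.
Qed.

End lebesgue_facts.

(** * The stationary renewal process *)

Section steps.
Context (R : realType) (u : nat -> R).
Hypotheses (u_le : forall n, u n <= u n.+1) (u_dvg : forall x, exists n, x < u n).

Lemma step_nondecreasing i j : (i <= j)%N -> u i <= u j.
Proof.
elim: j => [|j IH]; first by rewrite leqn0 => /eqP ->.
rewrite leq_eqVlt => /predU1P[->//|]; rewrite ltnS => /IH /le_trans; apply.
exact: u_le.
Qed.

Lemma step_exists x : u 0%N <= x -> exists n, u n <= x < u n.+1.
Proof.
move=> x0; pose Q n := x < u n.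
have [n nQ] := u_dvg x.
have exQ : exists n, Q n by exists n.
case: (ex_minnP exQ) => -[|k] Qk kmin; first by move: Qk; rewrite /Q ltNge x0.
exists k; rewrite [X in _ && X]Qk andbT leNgt; apply/negP => /kmin.
by rewrite ltnn.
Qed.

Lemma step_unique x i j : u i <= x < u i.+1 -> u j <= x < u j.+1 -> i = j.
Proof.
move=> /andP[ix xi] /andP[jx xj]; apply/eqP; rewrite eqn_leq.
apply/andP; split; rewrite leqNgt; apply/negP => /step_nondecreasing ij.
  by have := lt_le_trans xj (le_trans ij ix); rewrite ltxx.
by have := lt_le_trans xi (le_trans ij jx); rewrite ltxx.
Qed.

Lemma step_trivIset : trivIset setT (fun n => `[u n, u n.+1[%classic).
Proof.
apply/trivIsetP => i j _ _ /eqP ij; apply/seteqP; split => x //=.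
by rewrite !in_itv/= => -[xi xj]; apply: ij; exact: step_unique xi xj.
Qed.

Lemma step_bigcup : \bigcup_n `[u n, u n.+1[%classic = `[u 0%N, +oo[%classic.
Proof.
apply/seteqP; split => x /=.
  move=> [n _] /=; rewrite !in_itv/= andbT => /andP[+ _].
  by apply: le_trans; exact: step_nondecreasing.
rewrite in_itv/= andbT => /step_exists[n nx]; by exists n => //=; rewrite in_itv.
Qed.

End steps.

Section renewal.
Context d (T : measurableType d) (R : realType) (P : probability T R).
Variables (tau : nat -> T -> R) (m : R).
Hypotheses (mtau : forall n, measurable_fun setT (tau n))
  (tau_ge0 : forall n w, 0 <= tau n w) (m_gt0 : 0 < m).

(* Shifted with respect to [resampling_epoch]: [epoch 0] is time 0. *)
Definition epoch n w : R := \sum_(i < n) tau i w.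
Definition walk n w : R := \sum_(i < n) tau i.+1 w.
Definition tail x : R := fine (P (tau 1%N @^-1` `]x, +oo[)).

Hypotheses
  (tau0_law : has_density P (tau 0%N) (fun x => if 0 <= x then tail x / m else 0))
  (tau_law : forall n, identically_distributed P (tau n.+1) (tau 1%N))
  (tau0_walk : forall n A B, measurable A -> measurable B ->
    P (walk n @^-1` A `&` tau 0%N @^-1` B) =
    (P (walk n @^-1` A) * P (tau 0%N @^-1` B))%E)
  (walk_tau : forall n A B, measurable A -> measurable B ->
    P (walk n @^-1` A `&` tau n.+1 @^-1` B) =
    (P (walk n @^-1` A) * P (tau n.+1 @^-1` B))%E)
  (epoch_tau : forall n A B, measurable A -> measurable B ->
    P (epoch n.+1 @^-1` A `&` tau n.+1 @^-1` B) =
    (P (epoch n.+1 @^-1` A) * P (tau n.+1 @^-1` B))%E)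
  (walk_dvg : {ae P, forall w, forall x, exists n, x < walk n w}).

Lemma measurable_walk n : measurable_fun setT (walk n).
Proof. exact: measurable_sum. Qed.

Lemma measurable_epoch n : measurable_fun setT (epoch n).
Proof. exact: measurable_sum. Qed.

Lemma epochS n w : epoch n.+1 w = tau 0%N w + walk n w.
Proof. by rewrite /epoch big_ord_recl. Qed.

Lemma walkS n w : walk n.+1 w = walk n w + tau n.+1 w.
Proof. by rewrite /walk big_ord_recr. Qed.

Lemma walk_le n w : walk n w <= walk n.+1 w.
Proof. by rewrite walkS lerDl. Qed.

Lemma tail_ge0 x : 0 <= tail x. Proof. exact: fine_ge0. Qed.

(** The index [n] is free: every later interval has the same law, and [renewal_step] takes the one
    that follows [walk n]. *)
Lemma tailE n x :
  ((tail x)%:E = \int[P]_w (if (x < tau n.+1 w)%R then 1 else 0))%E.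
Proof.
have m1 : measurable (tau 1%N @^-1` `]x, +oo[).
  by rewrite -[X in measurable X]setTI; exact: mtau.
have mn : measurable (tau n.+1 @^-1` `]x, +oo[).
  by rewrite -[X in measurable X]setTI; exact: mtau.
rewrite /tail fineK ?fin_num_measure//.
rewrite -(tau_law n)// -[LHS]mul1e -[LHS]integral_cst// integral_mkcond.
apply: eq_integral => w _; rewrite patchE.
suff -> : (w \in tau n.+1 @^-1` `]x, +oo[) = (x < tau n.+1 w) by case: ifP.
by apply/idP/idP; rewrite inE/= in_itv/= andbT.
Qed.

Lemma measurable_tail : measurable_fun setT tail.
Proof.
apply: nonincreasing_measurable => // x y xy.
have mt z : measurable (tau 1%N @^-1` `]z, +oo[).
  by rewrite -[X in measurable X]setTI; exact: mtau.
rewrite /tail fine_le ?fin_num_measure// le_measure ?inE//.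
by apply: preimage_subset; exact: subitvPl.
Qed.

(** The interval is an indicator inside the integrand so that joint measurability in [(u, y)]
    follows from Tonelli. *)
Definition window (phi : R -> \bar R) (u y : R) : \bar R :=
  (\int[lebesgue_measure]_x if ((u <= x) && (x < u + y))%R then phi x else 0)%E.

Lemma windowE phi u y : window phi u y =
  (\int[lebesgue_measure]_(x in `[u, (u + y)%R[) phi x)%E.
Proof.
rewrite /window [RHS]integral_mkcond; apply: eq_integral => x _.
by rewrite patchE mem_setE in_itv.
Qed.

Section phi.
Variables (phi : R -> \bar R).
Hypotheses (mphi : measurable_fun setT phi) (phi0 : forall x, (0 <= phi x)%E).

Lemma window_ge0 u y : (0 <= window phi u y)%E.
Proof. by apply: integral_ge0 => x _; case: ifP. Qed.

Lemma measurable_window : measurable_fun [set: R * R] (fun z => window phi z.1 z.2).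
Proof.
apply: (@measurable_lebesgue_section _ (R * R)%type R
  (fun z => if ((z.1.1 <= z.2) && (z.2 < z.1.1 + z.1.2))%R then phi z.2 else 0)%E).
- apply: measurable_fun_ifT => //; last exact: measurableT_comp.
  apply: measurable_and.
    by apply: measurable_fun_ler => //; exact: measurableT_comp.
  apply: measurable_fun_ltr => //; apply: measurable_funD => //;
    exact: measurableT_comp.
- by move=> z; case: ifP.
Qed.

(* The residual density turns the integral over tau_0 into the expected integral
   over an interval whose length is an independent copy of tau_(n+1). *)
Lemma renewal_step n :
  (\int[P]_w phi (epoch n.+1 w) =
   m^-1%:E * \int[P]_w window phi (walk n w) (tau n.+1 w))%E.
Proof.
have V0 : (0 <= m^-1%:E :> \bar R)%E by rewrite lee_fin invr_ge0 ltW.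
(* Both sides are disintegrated along [walk n], which is independent of [tau 0%N] and of [tau n.+1];
   it then suffices to compare them at a fixed [u = walk n w]. *)
transitivity (\int[P]_w \int[P]_v phi (tau 0%N v + walk n w)%R)%E.
  under eq_integral do rewrite epochS.
  apply: (@integral_indep2 _ _ _ P _ _ R R (walk n) (tau 0%N)
    (fun z => phi (z.2 + z.1)%R)) => //.
  - exact: measurable_walk.
  - exact: tau0_walk.
  - by apply: measurableT_comp => //; exact: measurable_funD.
rewrite (@integral_indep2 _ _ _ P _ _ R R (walk n) (tau n.+1)
  (fun z => window phi z.1 z.2))//; last 4 first.
- exact: measurable_walk.
- exact: walk_tau.
- exact: measurable_window.
- by move=> z; exact: window_ge0.
rewrite -ge0_integralZl//; last 2 first.
- apply: (@measurable_fun_fubini_tonelli_F _ _ T T R P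
    (fun z => window phi (walk n z.1) (tau n.+1 z.2))); last first.
    by move=> z; exact: window_ge0.
  apply: (measurableT_comp (f := fun z => window phi z.1 z.2)
    (g := fun z : T * T => (walk n z.1, tau n.+1 z.2)) measurable_window).
  apply: measurable_fun_pair; apply: measurableT_comp => //.
  exact: measurable_walk.
- by move=> w _; apply: integral_ge0 => v _; exact: window_ge0.
apply: eq_integral => w _; set u := walk n w.
have mphiu : measurable_fun setT (fun x : R => phi (x + u)).
  by apply: measurableT_comp => //; exact: measurable_funD.
rewrite (has_density_integral (mtau 0%N) tau0_law mphiu)//.
pose g (z : T * R) : \bar R :=
  if (0 <= z.2) && (z.2 < tau n.+1 z.1) then phi (z.2 + u) else 0%E.
have mg : measurable_fun setT g.
  apply: measurable_fun_ifT => //; last exact: measurableT_comp mphiu _.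
  apply: measurable_and; first exact: measurable_fun_ler.
  by apply: measurable_fun_ltr => //; exact: measurableT_comp.
have g0 z : (0 <= g z)%E by rewrite /g; case: ifP.
(* The factor [tail x] of the residual density becomes the expectation of the indicator of
   [x < tau n.+1 v], which confines [x] to an interval of random length. *)
transitivity (\int[lebesgue_measure]_x \int[P]_v (m^-1%:E * g (v, x)))%E.
  apply: eq_integral => x _; rewrite ge0_integralZl//; last first.
    exact: measurableT_comp mg _.
  rewrite /g/=; case: ifP => x0 /=; last by rewrite mule0 integral0 mule0.
  rewrite EFinM (tailE n) muleA [RHS]muleC; congr (_ * _)%E.
  rewrite -ge0_integralZl//; last 2 first.
  - apply: measurable_fun_ifT => //; exact: measurable_fun_ltr.
  - by move=> v _; case: ifP.
  by apply: eq_integral => v _; case: ifP => _; rewrite ?mule1 ?mule0.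
rewrite -(@lebesgue_tonelli _ _ _ P (fun z => m^-1%:E * g z)%E); last 2 first.
- exact: measurable_funeM.
- by move=> z; exact: mule_ge0.
transitivity (\int[P]_v (m^-1%:E * \int[lebesgue_measure]_x g (v, x)))%E.
  apply: eq_integral => v _; rewrite ge0_integralZl//.
  exact: (measurableT_comp mg (pair1_measurable v)).
transitivity (m^-1%:E * \int[P]_v \int[lebesgue_measure]_x g (v, x))%E.
  apply: ge0_integralZl => //; first exact: measurable_lebesgue_section.
  by move=> v _; exact: integral_ge0.
congr (_ * _)%E; apply: eq_integral => v _.
pose h (x : R) : \bar R := if (u <= x) && (x < u + tau n.+1 v) then phi x else 0%E.
rewrite [RHS](_ : _ = \int[lebesgue_measure]_x h x)%E//.
(* Translating by [u] carries [[0, tau n.+1 v[] to [[u, u + tau n.+1 v[]. *)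
rewrite -(@lebesgue_integral_shift R h u)//; last 2 first.
- apply: measurable_fun_ifT => //.
  apply: measurable_and; [exact: measurable_fun_ler|exact: measurable_fun_ltr].
- by move=> x; rewrite /h; case: ifP.
by apply: eq_integral => x _; rewrite /g /h/= lerDr [x + u]addrC ltrD2l.
Qed.

(** This is stationarity: the expected number of epochs per unit of time is [1 / m] everywhere,
    tested against a nonnegative [phi]. *)
Lemma renewal_measure :
  (\sum_(0 <= n <oo) \int[P]_w phi (epoch n.+1 w) =
   m^-1%:E * \int[lebesgue_measure]_(x in `[0%R, +oo[) phi x)%E.
Proof.
under eq_eseriesr do rewrite renewal_step.
have mW n : measurable_fun setT (fun w => window phi (walk n w) (tau n.+1 w)).
  apply: (measurableT_comp (f := fun z => window phi z.1 z.2)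
    (g := fun w => (walk n w, tau n.+1 w)) measurable_window).
  by apply: measurable_fun_pair => //; exact: measurable_walk.
rewrite nneseriesZl; last first.
  by move=> n _; apply: integral_ge0 => w _; exact: window_ge0.
congr (_ * _)%E; rewrite -integral_nneseries//; last first.
  by move=> n w _; exact: window_ge0.
transitivity (\int[P]_w \int[lebesgue_measure]_(x in `[0%R, +oo[) phi x)%E; last first.
  by rewrite integral_cst//= probability_setT mule1.
apply: ge0_ae_eq_integral => //.
- by apply: ge0_emeasurable_sum => // n w _ _; exact: window_ge0.
- by move=> w _; apply: nneseries_ge0 => n _ _; exact: window_ge0.
- by move=> w _; exact: integral_ge0.
(* Although each window is random, their sum is almost surely the deterministic integral of [phi],
   because the windows tile the half-line. *)
move: walk_dvg; apply: filterS => w dvg _.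
under eq_eseriesr do rewrite windowE -walkS.
have w0 : walk 0 w = 0 by rewrite /walk big_ord0.
rewrite -w0 -(step_bigcup (walk_le ^~ w) dvg) ge0_integral_bigcup//.
- exact: measurable_funTS.
- exact: step_trivIset (walk_le ^~ w).
Qed.

End phi.

(** * Second moments of the interval lengths cut off at [t] *)

Section occupation.
Variables (t : R).
Hypothesis t_ge0 : 0 <= t.

(** Truncating both endpoints at [t] treats alike the intervals before, across and after [t], and
    makes the lengths telescope. *)
Definition occupation n w : R :=
  Num.min (epoch n.+1 w) t - Num.min (epoch n w) t.

Let overlap (x y : R) : R := Num.min (x + y) t - Num.min x t.

(** The overlap is the minimum of [y] and the positive part of [t - x]. Integrating [2 * z] up to it
    separates the conditions on [y] and on [x], and [y] enters only through the indicator of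
    [z < y]. *)
Lemma overlap_sqr (x y : R) : 0 <= x -> 0 <= y ->
  ((overlap x y ^+ 2)%:E = \int[lebesgue_measure]_z
     if ((0 <= z) && (z < y) && (z < t - x))%R then (2 * z)%:E else 0)%E.
Proof.
move=> x0 y0.
have -> : overlap x y = Num.max 0 (Num.min y (t - x)).
  rewrite /overlap; case: (leP x t) => xt.
    rewrite addr_minl addrAC subrr add0r.
    by apply/esym/max_idPr; rewrite le_min y0 subr_ge0.
  rewrite min_r ?subrr; last by rewrite (le_trans (ltW xt))// lerDl.
  by apply/esym/max_idPl; rewrite ge_min subr_le0 (ltW xt) orbT.
rewrite -integral_2x; last by rewrite le_max lexx.
rewrite integral_mkcond; apply: eq_integral => z _.
rewrite patchE mem_setE in_itv/= lt_max lt_min.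
by case: (leP 0 z) => //= z0.
Qed.

Lemma occupation0 w : occupation 0 w = Num.min (tau 0%N w) t.
Proof.
by rewrite /occupation /epoch big_ord0 big_ord1 (min_l t_ge0) subr0.
Qed.

Lemma occupationS n w : occupation n.+1 w = overlap (epoch n.+1 w) (tau n.+1 w).
Proof. by rewrite /occupation /overlap [epoch n.+2 w]/epoch big_ord_recr. Qed.

Lemma measurable_overlap : measurable_fun [set: R * R] (fun z => overlap z.1 z.2).
Proof.
apply: measurable_funB; apply: measurable_minr => //.
exact: measurable_funD.
Qed.

Lemma measurable_occupation n : measurable_fun setT (occupation n).
Proof.
by apply: measurable_funB; apply: measurable_minr => //; exact: measurable_epoch.
Qed.

Lemma epoch_ge0 n w : 0 <= epoch n w.
Proof. exact: sumr_ge0. Qed.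

Lemma integral_occupation0_sqr : (\int[P]_w (occupation 0 w ^+ 2)%:E =
  m^-1%:E * \int[lebesgue_measure]_(x in `[0%R, +oo[) (Num.min x t ^+ 2 * tail x)%:E)%E.
Proof.
under eq_integral do rewrite occupation0.
rewrite (has_density_integral (phi := fun x => (Num.min x t ^+ 2)%:E) (mtau 0%N) tau0_law);
  last 2 first.
- apply/measurable_EFinP; apply: measurable_funX; exact: measurable_minr.
- by move=> x; rewrite lee_fin sqr_ge0.
rewrite -ge0_integralZl//; last 3 first.
- apply/measurable_EFinP; apply: measurable_funTS; apply: measurable_funM.
    apply: measurable_funX; exact: measurable_minr.
  exact: measurable_tail.
- by move=> x _; rewrite lee_fin mulr_ge0 ?sqr_ge0 ?tail_ge0.
- by rewrite lee_fin invr_ge0 ltW.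
rewrite [RHS]integral_mkcond; apply: eq_integral => x _.
rewrite patchE mem_setE in_itv/= andbT; case: ifP; rewrite ?mule0// => _.
by rewrite -!EFinM mulrA mulrC.
Qed.

(** The renewal measure turns the sum into an integral over the starting point [x] of an interval.
    By [overlap_sqr] the expectation replaces the indicator of [z < tau 1] by [tail z]; integrating
    over [x] before [z] leaves the factor [t - z]. *)
Lemma sum_occupation_sqr : (\sum_(0 <= n <oo) \int[P]_w (occupation n.+1 w ^+ 2)%:E =
  m^-1%:E * \int[lebesgue_measure]_(z in `[0%R, t[) (2 * z * (t - z) * tail z)%:E)%E.
Proof.
pose phi (x : R) : \bar R := (\int[P]_v (overlap x (tau 1%N v) ^+ 2)%:E)%E.
have mo2 : measurable_fun [set: R * R] (fun z => (overlap z.1 z.2 ^+ 2)%:E).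
  by apply/measurable_EFinP; apply: measurable_funX; exact: measurable_overlap.
have o20 z : (0 <= (overlap z.1 z.2 ^+ 2)%:E)%E by rewrite lee_fin sqr_ge0.
have mphi : measurable_fun setT phi.
  apply: (@measurable_fun_fubini_tonelli_F _ _ R T R P
    (fun z => (overlap z.1 (tau 1%N z.2) ^+ 2)%:E)); last first.
    by move=> z; rewrite lee_fin sqr_ge0.
  apply: (measurableT_comp (g := fun z : R * T => (z.1, tau 1%N z.2)) mo2).
  by apply: measurable_fun_pair => //; exact: measurableT_comp.
have phi0 x : (0 <= phi x)%E.
  by apply: integral_ge0 => v _; rewrite lee_fin sqr_ge0.
transitivity (\sum_(0 <= n <oo) \int[P]_w phi (epoch n.+1 w))%E.
  apply: eq_eseriesr => n _; under eq_integral do rewrite occupationS.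
  transitivity (\int[P]_w \int[P]_v (overlap (epoch n.+1 w) (tau n.+1 v) ^+ 2)%:E)%E.
    apply: (@integral_indep2 _ _ _ P _ _ R R (epoch n.+1) (tau n.+1)
      (fun z => (overlap z.1 z.2 ^+ 2)%:E)) => //.
    - exact: measurable_epoch.
    - exact: epoch_tau.
  apply: eq_integral => w _ /=.
  apply: (identically_distributed_integral
    (f := fun y => (overlap (epoch n.+1 w) y ^+ 2)%:E)) => //.
  - exact: (measurableT_comp mo2 (pair1_measurable (epoch n.+1 w))).
  - by move=> y; rewrite lee_fin sqr_ge0.
rewrite renewal_measure//; congr (_ * _)%E.
pose g (z : R) : \bar R := (2 * z * tail z)%:E.
have mg : measurable_fun setT g.
  apply/measurable_EFinP; apply: measurable_funM measurable_tail.
  exact: measurable_funM.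
transitivity (\int[lebesgue_measure]_x \int[lebesgue_measure]_z
  if ((0 <= x) && (0 <= z) && (z < t - x))%R then g z else 0)%E.
  rewrite [LHS]integral_mkcond; apply: eq_integral => x _.
  rewrite patchE mem_setE in_itv/= andbT; case: (leP 0 x) => x0; last first.
    by rewrite integral0.
  pose h z : \bar R := if (0 <= z.2) && (z.2 < tau 1%N z.1) && (z.2 < t - x)
    then (2 * z.2)%:E else 0%E.
  transitivity (\int[P]_v \int[lebesgue_measure]_z h (v, z))%E.
    by apply: eq_integral => v _; rewrite overlap_sqr.
  have mh : measurable_fun [set: T * R] h.
    apply: measurable_fun_ifT => //; last first.
      by apply/measurable_EFinP; exact: measurable_funM.
    apply: measurable_and; last exact: measurable_fun_ltr.
    apply: measurable_and; first exact: measurable_fun_ler.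
    by apply: measurable_fun_ltr => //; exact: measurableT_comp.
  rewrite lebesgue_tonelli//; last first.
    move=> z; rewrite /h; case: ifP => //= /andP[/andP[z0 _] _].
    by rewrite lee_fin mulr_ge0.
  apply: eq_integral => z _; rewrite /h /=.
  case: (leP 0 z) => z0 /=; last by rewrite integral0.
  case: (ltP z (t - x)) => ztx; last by under eq_integral do rewrite andbF; rewrite integral0.
  rewrite /g [RHS]EFinM (tailE 0%N) -ge0_integralZl//; last 3 first.
  - apply: measurable_fun_ifT => //; exact: measurable_fun_ltr.
  - by move=> v _; case: ifP.
  - by rewrite lee_fin mulr_ge0.
  by apply: eq_integral => v _; rewrite andbT; case: ifP; rewrite ?mule1 ?mule0.
rewrite (@lebesgue_tonelli _ (measurableTypeR R) R (@lebesgue_measure R)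
  (fun z => if (0 <= z.1) && (0 <= z.2) && (z.2 < t - z.1) then g z.2 else 0)%R); last 2 first.
- apply: measurable_fun_ifT => //; last exact: measurableT_comp mg _.
  apply: measurable_and.
    by apply: measurable_and; exact: measurable_fun_ler.
  by apply: measurable_fun_ltr => //; exact: measurable_funB.
- move=> z; case: ifP => //= /andP[/andP[_ z0] _].
  by rewrite lee_fin mulr_ge0 ?mulr_ge0 ?tail_ge0.
rewrite [RHS]integral_mkcond; apply: eq_integral => z _.
rewrite patchE mem_setE in_itv/=; case: (leP 0 z) => z0 /=; last first.
  by under eq_integral do rewrite andbF; rewrite integral0.
(* Read in [x], the condition [z < t - x] is [x < t - z], and [g z] is constant there. *)
transitivity (\int[lebesgue_measure]_(x in `[0%R, (t - z)%R[) g z)%E.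
  rewrite [RHS]integral_mkcond; apply: eq_integral => x _.
  rewrite patchE mem_setE in_itv/= andbT.
  by rewrite ltrBrDr ltrBrDr [z + x]addrC.
transitivity (g z * lebesgue_measure `[0%R, (t - z)%R[%classic)%E.
  by rewrite integral_cst.
rewrite lebesgue_measure_itv/= lte_fin sube0.
rewrite subr_gt0; case: ltP => zt; last by rewrite mule0.
by rewrite -EFinM mulrAC.
Qed.

(** Read off from the total mass one of the residual density, without integrating [xi] itself. *)
Lemma integral_tail :
  (\int[lebesgue_measure]_(x in `[0%R, +oo[) (tail x)%:E = m%:E)%E.
Proof.
have [_ _ /(_ setT measurableT)] := tau0_law.
rewrite preimage_setT probability_setT => /esym E.
have : (m%:E * \int[lebesgue_measure]_x
    (if (0 <= x)%R then tail x / m else 0)%:E = m%:E)%E by rewrite E mule1.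
rewrite -ge0_integralZl//; last 3 first.
- by case: tau0_law => mg _ _; exact/measurable_EFinP.
- by move=> x _; case: ifP => _; rewrite lee_fin ?divr_ge0 ?tail_ge0// ltW.
- by rewrite lee_fin ltW.
move=> <-; rewrite [LHS]integral_mkcond; apply: eq_integral => x _.
rewrite patchE mem_setE in_itv/= andbT; case: ifP => _; last by rewrite mule0.
by rewrite -EFinM mulrCA divff ?mulr1// gt_eqF.
Qed.

Lemma integral_tail_itv : exists b, 0 <= b /\
  (\int[lebesgue_measure]_(x in `[t, +oo[) (tail x)%:E = b%:E)%E.
Proof.
exists (fine (\int[lebesgue_measure]_(x in `[t, +oo[) (tail x)%:E)).
have I0 : (0 <= \int[lebesgue_measure]_(x in `[t, +oo[) (tail x)%:E)%E.
  by apply: integral_ge0 => x _; rewrite lee_fin tail_ge0.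
split; first exact: fine_ge0.
rewrite fineK// ge0_fin_numE//; apply: le_lt_trans (ltry m).
rewrite -integral_tail; apply: ge0_subset_integral => //.
- by apply/measurable_EFinP; apply: measurable_funTS; exact: measurable_tail.
- by move=> x _; rewrite lee_fin tail_ge0.
- by apply: subset_itvr; rewrite bnd_simp.
Qed.

Lemma occupation_sqr_series :
  (\sum_(0 <= n <oo) \int[P]_w (occupation n w ^+ 2)%:E =
   (2 / m * (\int[lebesgue_measure]_(u in `[0, t]) ((t * u - u ^+ 2 / 2) * tail u) +
     t ^+ 2 / 2 * \int[lebesgue_measure]_(u in `[t, +oo[) tail u)%R)%:E)%E.
Proof.
have mt : measurable_fun setT tail by exact: measurable_tail.
have mmin : measurable_fun setT (fun x : R => (Num.min x t ^+ 2 * tail x)%:E).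
  apply/measurable_EFinP; apply: measurable_funM => //.
  by apply: measurable_funX; exact: measurable_minr.
have t0 x := tail_ge0 x.
(* The first length is set apart: it starts at time 0 and follows the residual law, whereas the
   renewal measure counts the epochs from the first resampling on. *)
rewrite (nneseries_split 0 1); last first.
  by move=> k _; apply: integral_ge0 => w _; rewrite lee_fin sqr_ge0.
rewrite add0n big_nat1.
rewrite -(nneseries_addn 1%N); last first.
  by move=> k; apply: integral_ge0 => w _; rewrite lee_fin sqr_ge0.
under eq_eseriesr do rewrite addn1.
rewrite sum_occupation_sqr integral_occupation0_sqr -ge0_muleDr; last 2 first.
- by apply: integral_ge0 => x _; rewrite lee_fin mulr_ge0 ?sqr_ge0.
- apply: integral_ge0 => x /=; rewrite in_itv/= => /andP[x0 xt].
  by rewrite lee_fin !mulr_ge0// subr_ge0 ltW.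
(* Splitting at [t], where the minimum of [x] and [t] changes form; only the first length
   contributes beyond [t]. *)
have -> : `[0%R, +oo[%classic = `[0%R, t[ `|` `[t, +oo[ :> set R.
  apply/seteqP; split => x /=; rewrite !in_itv/= !andbT.
    by move=> x0; case: (ltP x t); [left; rewrite x0|right].
  by move=> [/andP[]//|]; exact: le_trans.
rewrite ge0_integral_setU//=; last 3 first.
- exact: measurable_funTS.
- by move=> x _; rewrite lee_fin mulr_ge0 ?sqr_ge0.
- apply/disj_set2P/seteqP; split => x //=; rewrite !in_itv/= andbT.
  by move=> -[/andP[_ xt] tx]; move: xt; rewrite ltNge tx.
rewrite addeAC -ge0_integralD//; last 4 first.
- by move=> x _; rewrite lee_fin mulr_ge0 ?sqr_ge0.
- exact: measurable_funTS.
- move=> x /=; rewrite in_itv/= => /andP[x0 xt].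
  by rewrite lee_fin !mulr_ge0// subr_ge0 ltW.
- apply/measurable_EFinP; apply: measurable_funTS; apply: measurable_funM => //.
  apply: measurable_funM; first exact: measurable_funM.
  exact: measurable_funB.
(* On [[0, t[] the two contributions add up to [u ^+ 2 + 2 * u * (t - u) = 2 * (t * u - u ^+ 2 /
   2)], which is where the polynomial of the formula comes from. *)
pose q u := (t * u - u ^+ 2 / 2) * tail u.
have mq : measurable_fun setT q.
  apply: measurable_funM => //; apply: measurable_funB; first exact: measurable_funM.
  by apply: measurable_funM => //; exact: measurable_funX.
have q0 u : 0 <= u < t -> 0 <= q u <= t ^+ 2 * tail u.
  move=> /andP[u0 ut]; apply/andP; split.
    by rewrite mulr_ge0//; nra.
  by rewrite ler_wpM2r//; nra.
have [b [b0 bE]] := integral_tail_itv.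
(* Finiteness, needed to pass to real-valued integrals, comes from the bound by [t ^+ 2 * tail u],
   whose integral is [t ^+ 2 * m]. *)
have qfin : (\int[lebesgue_measure]_(u in `[0%R, t[) (q u)%:E \is a fin_num)%E.
  have qI0 : (0 <= \int[lebesgue_measure]_(u in `[0%R, t[) (q u)%:E)%E.
    apply: integral_ge0 => u; rewrite /= in_itv/= => /q0 /andP[+ _].
    by rewrite lee_fin.
  rewrite ge0_fin_numE//; apply: le_lt_trans (ltry (t ^+ 2 * m)).
  rewrite EFinM -integral_tail -ge0_integralZl//; last 3 first.
  - by apply/measurable_EFinP; exact: measurable_funTS.
  - by move=> x _; rewrite lee_fin.
  - by rewrite lee_fin sqr_ge0.
  apply: (@le_trans _ _ (\int[lebesgue_measure]_(x in `[0%R, t[) ((t ^+ 2)%:E * (tail x)%:E))%E).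
    apply: ge0_le_integral => //.
    - by move=> u; rewrite /= in_itv/= => /q0 /andP[+ _]; rewrite lee_fin.
    - by apply/measurable_EFinP; exact: measurable_funTS.
    - apply/measurable_funeM/measurable_EFinP; exact: measurable_funTS.
    - by move=> u; rewrite /= in_itv/= => /q0 /andP[_ +]; rewrite lee_fin.
  apply: ge0_subset_integral => //.
  - apply/measurable_funeM/measurable_EFinP; exact: measurable_funTS.
  - by move=> x _; rewrite -EFinM lee_fin mulr_ge0 ?sqr_ge0.
  - exact: subset_itvl.
transitivity (m^-1%:E * (2%:E * \int[lebesgue_measure]_(u in `[0%R, t[) (q u)%:E +
  (t ^+ 2)%:E * \int[lebesgue_measure]_(u in `[t, +oo[) (tail u)%:E))%E.
  congr (_ * (_ + _))%E; rewrite -ge0_integralZl//.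
  - apply: eq_integral => x; rewrite inE/= in_itv/= => /andP[x0 xt].
    rewrite min_l ?(ltW xt)// -EFinD -EFinM; congr EFin; rewrite /q; by field.
  - by apply/measurable_EFinP; exact: measurable_funTS.
  - by move=> u; rewrite /= in_itv/= => /q0 /andP[+ _]; rewrite lee_fin.
  - apply: eq_integral => x; rewrite inE/= in_itv/= andbT => tx.
    by rewrite min_r.
  - by apply/measurable_EFinP; exact: measurable_funTS.
  - by move=> x _; rewrite lee_fin.
  - by rewrite lee_fin sqr_ge0.
rewrite /Rintegral bE /= -integral_itv_bndo_bndc; last first.
  by apply/measurable_EFinP; exact: measurable_funTS.
rewrite -(fineK qfin) -!(EFinM, EFinD); congr EFin; rewrite /q; field.
by rewrite lt0r_neq0.
Qed.

End occupation.
End renewal.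

(** * Moments of mixed sums *)

Section mixture.
Context d (T : measurableType d) (R : realType) (P : probability T R).

Lemma is_cvg_EFin_nondecreasing (u : nat -> R) : (forall n, u n <= u n.+1) ->
  cvgn (fun n => (u n)%:E).
Proof.
move=> u_le; apply: ereal_nondecreasing_is_cvgn; apply/nondecreasing_seqP => n.
by rewrite lee_fin.
Qed.

Lemma measurable_limn_nondecreasing (f : nat -> T -> R) :
    (forall n, measurable_fun setT (f n)) -> (forall n w, f n w <= f n.+1 w) ->
  measurable_fun setT (fun w => limn (fun n => (f n w)%:E)).
Proof.
move=> mf f_le; apply: (emeasurable_fun_cvg (fun n w => (f n w)%:E)).
- by move=> n; exact/measurable_EFinP.
- by move=> w _; apply: is_cvg_EFin_nondecreasing.
Qed.

(** Monotone convergence to the extended-real limit, which is defined everywhere; the eventual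
    equality identifies this limit with [g] off a null set. *)
Lemma cvg_integral_eventually (f : nat -> T -> R) (g : T -> R) :
    (forall n, measurable_fun setT (f n)) -> measurable_fun setT g ->
    (forall n w, 0 <= f n w) -> (forall w, 0 <= g w) ->
    (forall n w, f n w <= f n.+1 w) ->
    {ae P, forall w, exists N, forall n, (N <= n)%N -> f n w = g w} ->
  (\int[P]_w (f n w)%:E @[n --> \oo] --> \int[P]_w (g w)%:E)%E.
Proof.
move=> mf mg f0 g0 f_le fg.
have mE n : measurable_fun setT (fun w => (f n w)%:E) by exact/measurable_EFinP.
have -> : (\int[P]_w (g w)%:E = \int[P]_w limn (fun n => (f n w)%:E))%E.
  apply: ge0_ae_eq_integral => //.
  - exact/measurable_EFinP.
  - exact: measurable_limn_nondecreasing.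
  - by move=> w _; rewrite lee_fin.
  - move=> w _; apply: lime_ge; first exact: is_cvg_EFin_nondecreasing.
    by apply: nearW => n; rewrite lee_fin.
  - move: fg; apply: filterS => w [N fN] _; apply/esym/lim_near_cst => //.
    by exists N => // n /= /fN ->.
apply: cvg_monotone_convergence => //.
- by move=> n w _; rewrite lee_fin.
- move=> w _ i j ij; rewrite lee_fin.
  exact: (step_nondecreasing (u := f ^~ w)).
Qed.

Variables (ell : nat -> T -> R) (t : R).
Hypotheses (mell : forall n, measurable_fun setT (ell n))
  (ell_ge0 : forall n w, 0 <= ell n w)
  (ell_le : forall n w, ell n w <= t)
  (ell_sum : {ae P, forall w, exists N, (forall n, (N <= n)%N -> ell n w = 0) /\
     \sum_(i < N) ell i w = t}).

Definition partial_mixture (a : nat -> T -> R) N w := \sum_(i < N) a i w * ell i w.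

(** For nonnegative rates the limit exists in the extended reals at every [w], which gives a
    function measurable everywhere. [fine] alters only the value [+oo], which occurs on a null set
    because almost surely the lengths eventually vanish. *)
Definition mixture (a : nat -> T -> R) w : R :=
  fine (limn (fun N => (partial_mixture a N w)%:E)).

Lemma partial_mixture_stable a w N : (forall n, (N <= n)%N -> ell n w = 0) ->
  forall n, (N <= n)%N -> partial_mixture a n w = partial_mixture a N w.
Proof.
move=> N0 n Nn; rewrite /partial_mixture -!(big_mkord xpredT (fun i => a i w * ell i w)).
rewrite (big_cat_nat _ Nn)//= -[RHS]addr0; congr (_ + _).
rewrite big_nat_cond big1//.
by move=> i /andP[/andP[/N0 -> _] _]; rewrite mulr0.
Qed.

Lemma mixtureE a w N : (forall n, (N <= n)%N -> ell n w = 0) ->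
  mixture a w = partial_mixture a N w.
Proof.
move=> N0; rewrite /mixture (@lim_near_cst _ _ _ _ _ (partial_mixture a N w)%:E)//.
by exists N => // n /= Nn; rewrite (partial_mixture_stable a N0).
Qed.

Section nonnegative_rates.
Variables (a : nat -> T -> R).
Hypotheses (ma : forall n, measurable_fun setT (a n)) (a0 : forall n w, 0 <= a n w).

Lemma measurable_partial_mixture N : measurable_fun setT (partial_mixture a N).
Proof. by apply: measurable_sum => i; exact: measurable_funM. Qed.

Lemma partial_mixture_ge0 N w : 0 <= partial_mixture a N w.
Proof. by apply: sumr_ge0 => i _; exact: mulr_ge0. Qed.

Lemma partial_mixture_le N w : partial_mixture a N w <= partial_mixture a N.+1 w.
Proof. by rewrite /partial_mixture big_ord_recr/= lerDl mulr_ge0. Qed.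

Lemma mixture_ge0 w : 0 <= mixture a w.
Proof.
apply: fine_ge0; apply: lime_ge.
  by apply: is_cvg_EFin_nondecreasing => n; exact: partial_mixture_le.
by apply: nearW => n; rewrite lee_fin partial_mixture_ge0.
Qed.

Lemma measurable_mixture : measurable_fun setT (mixture a).
Proof.
apply: measurableT_comp => //; apply: measurable_limn_nondecreasing.
  exact: measurable_partial_mixture.
by move=> n w; exact: partial_mixture_le.
Qed.

Lemma cvg_integral_mixture :
  (\int[P]_w (partial_mixture a n w)%:E @[n --> \oo] -->
   \int[P]_w (mixture a w)%:E)%E.
Proof.
apply: cvg_integral_eventually.
- exact: measurable_partial_mixture.
- exact: measurable_mixture.
- exact: partial_mixture_ge0.
- exact: mixture_ge0.
- exact: partial_mixture_le.
- move: ell_sum; apply: filterS => w [N [N0 _]]; exists N => n Nn.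
  by rewrite (mixtureE _ N0) (partial_mixture_stable _ N0).
Qed.

End nonnegative_rates.

Lemma cvg_integral_mixture_mul (a b : nat -> T -> R) :
    (forall n, measurable_fun setT (a n)) -> (forall n w, 0 <= a n w) ->
    (forall n, measurable_fun setT (b n)) -> (forall n w, 0 <= b n w) ->
  (\int[P]_w (partial_mixture a n w * partial_mixture b n w)%:E @[n --> \oo] -->
   \int[P]_w (mixture a w * mixture b w)%:E)%E.
Proof.
move=> ma a0 mb b0.
apply: (@cvg_integral_eventually (fun n w => partial_mixture a n w * partial_mixture b n w)).
- by move=> n; apply: measurable_funM; exact: measurable_partial_mixture.
- by apply: measurable_funM; exact: measurable_mixture.
- by move=> n w; apply: mulr_ge0; exact: partial_mixture_ge0.
- by move=> w; apply: mulr_ge0; exact: mixture_ge0.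
- by move=> n w; apply: ler_pM; rewrite ?partial_mixture_ge0 ?partial_mixture_le.
- move: ell_sum; apply: filterS => w [N [N0 _]]; exists N => n Nn.
  by rewrite !(mixtureE _ N0) !(partial_mixture_stable _ N0).
Qed.

Let e i j : R := fine (\int[P]_w (ell i w * ell j w)%:E)%E.

Let t_ge0 : 0 <= t.
Proof. exact: le_trans (ell_ge0 0 point) (ell_le 0 point). Qed.

Let eE i j : (\int[P]_w (ell i w * ell j w)%:E = (e i j)%:E)%E.
Proof.
have I0 : (0 <= \int[P]_w (ell i w * ell j w)%:E)%E.
  by apply: integral_ge0 => w _; rewrite lee_fin mulr_ge0.
rewrite /e fineK// ge0_fin_numE//; apply: le_lt_trans (ltry (t * t)).
apply: (@le_trans _ _ (\int[P]_w (t * t)%:E)%E); last first.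
  by rewrite integral_cst//= probability_setT mule1.
apply: ge0_le_integral => //.
- by move=> w _; rewrite lee_fin mulr_ge0.
- by apply/measurable_EFinP; exact: measurable_funM.
- by move=> w _; rewrite lee_fin ler_pM.
Qed.

(** Writing the diagonal coefficient [p] as [q + (p - q)] completes the double sum, so no
    off-diagonal [e i j] has to be known separately. *)
Lemma integral_partial_mixture_mul (a b : nat -> T -> R) (p q : R) N :
    (forall n, measurable_fun setT (a n)) -> (forall n w, 0 <= a n w) ->
    (forall n, measurable_fun setT (b n)) -> (forall n w, 0 <= b n w) ->
    (forall i j, (\int[P]_w (a i w * b j w * (ell i w * ell j w))%:E =
       (if i == j then p else q)%:E * \int[P]_w (ell i w * ell j w)%:E)%E) ->
  (\int[P]_w (partial_mixture a N w * partial_mixture b N w)%:E =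
   (q * (\sum_(i < N) \sum_(j < N) e i j) + (p - q) * \sum_(i < N) e i i)%:E)%E.
Proof.
move=> ma a0 mb b0 ab.
have mij i j : measurable_fun setT (fun w => (a i w * b j w * (ell i w * ell j w))%:E).
  by apply/measurable_EFinP; apply: measurable_funM; exact: measurable_funM.
have ij0 i j w : (0 <= (a i w * b j w * (ell i w * ell j w))%:E)%E.
  by rewrite lee_fin !mulr_ge0.
transitivity (\int[P]_w \sum_(i < N) \sum_(j < N)
    (a i w * b j w * (ell i w * ell j w))%:E)%E.
  apply: eq_integral => w _; rewrite /partial_mixture big_distrlr/=.
  rewrite -sumEFin; apply: eq_bigr => i _; rewrite -sumEFin.
  by apply: eq_bigr => j _; rewrite mulrACA.
rewrite ge0_integral_sum//; last 2 first.
- by move=> i; apply: emeasurable_sum.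
- by move=> i w _; exact: sume_ge0.
under eq_bigr do rewrite ge0_integral_sum//.
under eq_bigr do under eq_bigr do rewrite ab eE -EFinM.
under eq_bigr do rewrite sumEFin.
rewrite sumEFin; congr EFin.
rewrite !mulr_sumr -big_split/=; apply: eq_bigr => i _.
rewrite mulr_sumr [in LHS](bigD1 i)//= [in RHS](bigD1 i)//= eqxx.
rewrite -addrA [X in _ = _ + X]addrC addrA -mulrDl [q + _]addrC subrK.
congr (_ + _); apply: eq_bigr => j ji.
by rewrite ifN// eq_sym.
Qed.

(** The constant rate 1 has mixture [t]; it serves as a probe that evaluates the sums of moments of
    the lengths. *)
Let one (n : nat) (w : T) : R := 1.
Let mone n : measurable_fun setT (one n). Proof. exact: measurable_cst. Qed.
Let one0 n w : 0 <= one n w. Proof. exact: ler01. Qed.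

Let mixture_one : {ae P, forall w, mixture one w = t}.
Proof.
move: ell_sum; apply: filterS => w [N [N0 <-]].
rewrite (mixtureE _ N0) /partial_mixture.
by under eq_bigr do rewrite mul1r.
Qed.

Lemma integral_mixture_mul (a b : nat -> T -> R) (p q W : R) :
    (forall n, measurable_fun setT (a n)) -> (forall n w, 0 <= a n w) ->
    (forall n, measurable_fun setT (b n)) -> (forall n w, 0 <= b n w) ->
    (forall i j, (\int[P]_w (a i w * b j w * (ell i w * ell j w))%:E =
       (if i == j then p else q)%:E * \int[P]_w (ell i w * ell j w)%:E)%E) ->
    (\sum_(0 <= n <oo) \int[P]_w (ell n w ^+ 2)%:E = W%:E)%E ->
  (\int[P]_w (mixture a w * mixture b w)%:E = (q * t ^+ 2 + (p - q) * W)%:E)%E.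
Proof.
move=> ma a0 mb b0 ab WE.
have cab := cvg_integral_mixture_mul ma a0 mb b0.
(* Obtained from the rates [one], for which [p = q = 1] and both mixtures equal [t] almost
   surely. *)
have c1 : \sum_(i < N) \sum_(j < N) e i j @[N --> \oo] --> t ^+ 2.
  suff : ((\sum_(i < N) \sum_(j < N) e i j)%R%:E @[N --> \oo] --> (t ^+ 2)%:E)%E.
    exact: fine_cvg.
  have c11 := cvg_integral_mixture_mul mone one0 mone one0.
  rewrite (_ : (t ^+ 2)%:E = (\int[P]_w (mixture one w * mixture one w)%:E)%E); last first.
    transitivity (\int[P]_w (t ^+ 2)%:E)%E.
      by rewrite integral_cst//= probability_setT mule1.
    apply: ge0_ae_eq_integral => //.
    - by apply/measurable_EFinP/measurable_funM; exact: measurable_mixture.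
    - by move=> w _; rewrite lee_fin sqr_ge0.
    - by move=> w _; rewrite lee_fin mulr_ge0 ?mixture_ge0.
    - by move: mixture_one; apply: filterS => w /= -> _.
  apply: cvg_trans c11; apply: near_eq_cvg; apply: nearW => N.
  rewrite (@integral_partial_mixture_mul _ _ 1 1)// ?subrr ?mul0r ?addr0 ?mul1r//.
  by move=> i j; rewrite if_same mul1e; under eq_integral do rewrite !mul1r.
have c2 : \sum_(i < N) e i i @[N --> \oo] --> W.
  suff : ((\sum_(i < N) e i i)%R%:E @[N --> \oo] --> W%:E)%E by exact: fine_cvg.
  rewrite -WE.
  have : cvgn (fun N => \sum_(0 <= n < N) \int[P]_w (ell n w ^+ 2)%:E)%E.
    by apply: is_cvg_nneseries => n _ _; apply: integral_ge0 => w _; rewrite lee_fin sqr_ge0.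
  apply: cvg_trans; apply: near_eq_cvg; apply: nearW => N.
  rewrite big_mkord -sumEFin; apply: eq_bigr => i _.
  by rewrite -eE; under eq_integral do rewrite expr2.
apply: (cvg_unique _ cab) => //.
pose S N := q * (\sum_(i < N) \sum_(j < N) e i j) + (p - q) * \sum_(i < N) e i i.
suff : ((S N)%:E @[N --> \oo] --> (q * t ^+ 2 + (p - q) * W)%:E)%E.
  apply: cvg_trans; apply: near_eq_cvg; apply: nearW => N.
  by rewrite (integral_partial_mixture_mul _ ma a0 mb b0 ab).
apply: cvg_EFin; first exact: nearW.
by apply: cvgD; apply: cvgM => //; exact: cvg_cst.
Qed.

Lemma integral_mixture (a : nat -> T -> R) (q : R) :
    (forall n, measurable_fun setT (a n)) -> (forall n w, 0 <= a n w) ->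
    (forall n, (\int[P]_w (a n w * ell n w)%:E =
       q%:E * \int[P]_w (ell n w)%:E)%E) ->
  (\int[P]_w (mixture a w)%:E = (q * t)%:E)%E.
Proof.
move=> ma a0 aq.
have ca := cvg_integral_mixture ma a0.
have c1 := cvg_integral_mixture mone one0.
have pmE (b : nat -> T -> R) N :
    (forall n, measurable_fun setT (b n)) -> (forall n w, 0 <= b n w) ->
    (\int[P]_w (partial_mixture b N w)%:E =
     \sum_(i < N) \int[P]_w (b i w * ell i w)%:E)%E.
  move=> mb b0; rewrite -ge0_integral_sum//; last 2 first.
  - by move=> i; apply/measurable_EFinP; exact: measurable_funM.
  - by move=> i w _; rewrite lee_fin mulr_ge0.
  by apply: eq_integral => w _; rewrite sumEFin.
have oneE : (\int[P]_w (mixture one w)%:E = t%:E)%E.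
  transitivity (\int[P]_w t%:E)%E; last first.
    by rewrite integral_cst//= probability_setT mule1.
  apply: ge0_ae_eq_integral => //.
  - by apply/measurable_EFinP; exact: measurable_mixture.
  - by move=> w _; rewrite lee_fin mixture_ge0.
  - by move: mixture_one; apply: filterS => w /= -> _.
apply: (cvg_unique _ ca) => //; rewrite EFinM -oneE.
suff : (q%:E * \int[P]_w (partial_mixture one N w)%:E @[N --> \oo] -->
    q%:E * \int[P]_w (mixture one w)%:E)%E.
  apply: cvg_trans; apply: near_eq_cvg; apply: nearW => N.
  rewrite (pmE _ _ ma a0) (pmE _ _ mone one0) ge0_sume_distrr; last first.
  by move=> i _; apply: integral_ge0 => w _; rewrite lee_fin mulr_ge0.
  apply: eq_bigr => i _; rewrite aq; congr (_ * _)%E.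
  by apply: eq_integral => w _; rewrite mul1r.
exact: cvgeZl.
Qed.

End mixture.

(** * Mixed Poisson variables *)

Section poisson_weights.
Context (R : realType).

(* [poisson_pmf] is constantly 1 at nonpositive rates. *)
Definition poisson_weight (r : R) (k : nat) : R :=
  if 0 < r then poisson_pmf r k else (k == 0)%:R.

Lemma poisson_weight_ge0 r k : 0 <= poisson_weight r k.
Proof. by rewrite /poisson_weight; case: ifP => // _; exact: poisson_pmf_ge0. Qed.

Lemma poisson_prob_set1 r k :
  poisson_prob r 0%N [set k] = (poisson_weight r k)%:E.
Proof.
rewrite /poisson_prob /poisson_weight; case: ifP => _.
  by rewrite esum_set1// lee_fin poisson_pmf_ge0.
rewrite diracE; congr ((nat_of_bool _)%:R%:E).
by apply/idP/idP; [rewrite inE/= => <-|move=> /eqP ->; rewrite inE].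
Qed.

Lemma measurable_poisson_weight k : measurable_fun setT (poisson_weight ^~ k).
Proof.
apply: measurable_fun_ifT => //; first exact: measurable_fun_ltr.
exact: measurable_poisson_pmf.
Qed.

Lemma poisson_weight_sum r : (\sum_(0 <= k <oo) (poisson_weight r k)%:E = 1)%E.
Proof.
transitivity (poisson_prob r 0%N [set: nat]); last exact: probability_setT.
rewrite (_ : [set: nat] = \bigcup_k [set k]); last first.
  by apply/seteqP; split => // k _; exists k.
rewrite measure_bigcup//; last first.
  by apply/trivIsetP => i j _ _ ij; apply/seteqP; split => // k /= [-> ji]; rewrite ji eqxx in ij.
apply/esym; rewrite (@eq_eseriesl _ _ xpredT); last by move=> k; rewrite in_setT.
by apply: eq_eseriesr => k _; exact: poisson_prob_set1.
Qed.

Lemma poisson_weight_mean r : 0 <= r ->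
  (\sum_(0 <= k <oo) (k%:R * poisson_weight r k)%:E = r%:E)%E.
Proof.
rewrite le_eqVlt => /predU1P[<-|r0].
  rewrite eseries0// => k _ _; rewrite /poisson_weight ltxx.
  by case: k => [|k]; rewrite ?mul0r ?mulr0.
rewrite (nneseries_split 0 1); last first.
  by move=> k _; rewrite lee_fin mulr_ge0 ?poisson_weight_ge0.
rewrite add0n big_nat1 mul0r add0e.
rewrite -(nneseries_addn 1%N); last first.
  by move=> k; rewrite lee_fin mulr_ge0 ?poisson_weight_ge0.
(* [k.+1] times the weight at [k.+1] is [r] times the weight at [k], so the shifted series is [r]
   times the total mass. *)
rewrite -[RHS]mule1 -(poisson_weight_sum r) -nneseriesZl; last first.
  by move=> k _; rewrite lee_fin poisson_weight_ge0.
apply: eq_eseriesr => k _; rewrite addn1 -EFinM; congr EFin.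
rewrite /poisson_weight r0 /poisson_pmf r0 factS natrM exprS.
have : k.+1%:R != 0 :> R by rewrite pnatr_eq0.
have : k`!%:R != 0 :> R by rewrite pnatr_eq0 -lt0n fact_gt0.
move: (k.+1%:R : R) (k`!%:R : R) (expR (- r)) => x y z y0 x0.
by field; rewrite x0 y0.
Qed.

End poisson_weights.

(** On each piece [N] is replaced by a constant. Measurability of [N] is asked only inside [D],
    because the resampling count along a path is identified only at nonnegative times. *)
Lemma integral_nat_partition d (T : measurableType d) (R : realType)
    (mu : {measure set T -> \bar R}) (D : set T) (N : T -> nat)
    (f : nat -> T -> \bar R) :
    (forall k, measurable (D `&` N @^-1` [set k])) ->
    (forall k, measurable_fun setT (f k)) -> (forall k w, (0 <= f k w)%E) ->
  (\int[mu]_(w in D) f (N w) w =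
   \sum_(0 <= k <oo) \int[mu]_(w in D `&` N @^-1` [set k]) f k w)%E.
Proof.
move=> mDN mf f0.
have DE : D = \bigcup_k (D `&` N @^-1` [set k]).
  apply/seteqP; split => w; first by move=> Dw; exists (N w).
  by move=> [k _ []].
rewrite {1}DE ge0_integral_bigcup//; last 2 first.
- rewrite -DE => mD B mB; rewrite (_ : _ `&` _ = \bigcup_k
      ((D `&` N @^-1` [set k]) `&` (f k) @^-1` B)); last first.
    apply/seteqP; split => w /=.
      by move=> [Dw fB]; exists (N w).
    by move=> [k _ /= [[Dw <-] fB]].
  apply: bigcup_measurable => k _; apply: measurableI => //.
  by rewrite -[X in measurable X]setTI; exact: mf.
- apply/trivIsetP => i j _ _ ij; apply/seteqP; split => // w /= [[_ wi] [_ wj]].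
  by rewrite -wi -wj eqxx in ij.
by apply: eq_eseriesr => k _; apply: eq_integral => w; rewrite inE => -[_ /= ->].
Qed.

Section poisson_moments.
Context d (T : measurableType d) (R : realType) (P : probability T R).

(** With [u] and [v] the identity or the constant 1, this single statement yields E[A], E[S] and
    E[A S]. The integral is cut along the values of [A] and [S], the joint law inserted on each
    piece, and the series resummed under the integral, first over [S], then over [A]. *)
Lemma integral_mixed_poisson (A S : T -> nat) (X Y : T -> R)
    (u v : nat -> R) (mu mv : R -> R) :
    measurable_fun setT A -> measurable_fun setT S ->
    measurable_fun setT X -> measurable_fun setT Y ->
    (forall w, 0 <= X w) -> (forall w, 0 <= Y w) ->
    (forall a b, P (A @^-1` [set a] `&` S @^-1` [set b]) =
       (\int[P]_w (poisson_weight (X w) a * poisson_weight (Y w) b)%:E)%E) ->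
    (forall k, 0 <= u k) -> (forall k, 0 <= v k) ->
    measurable_fun setT mu -> measurable_fun setT mv ->
    (forall r, 0 <= r -> (\sum_(0 <= k <oo) (u k * poisson_weight r k)%:E = (mu r)%:E)%E) ->
    (forall r, 0 <= r -> (\sum_(0 <= k <oo) (v k * poisson_weight r k)%:E = (mv r)%:E)%E) ->
  (\int[P]_w (u (A w) * v (S w))%:E = \int[P]_w (mu (X w) * mv (Y w))%:E)%E.
Proof.
move=> mA mS mX mY X0 Y0 AS u0 v0 mmu mmv uE vE.
have mA' k : measurable (A @^-1` [set k]).
  by rewrite -[X in measurable X]setTI; exact: mA.
have mS' k : measurable (S @^-1` [set k]).
  by rewrite -[X in measurable X]setTI; exact: mS.
have mpX k : measurable_fun setT (fun w => poisson_weight (X w) k).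
  exact: measurableT_comp (measurable_poisson_weight k) mX.
have mpY k : measurable_fun setT (fun w => poisson_weight (Y w) k).
  exact: measurableT_comp (measurable_poisson_weight k) mY.
have pw0 := @poisson_weight_ge0 R.
have mv0 w : 0 <= mv (Y w).
  by rewrite -lee_fin -vE//; apply: nneseries_ge0 => k _ _; rewrite lee_fin mulr_ge0.
rewrite (@integral_nat_partition _ _ _ P setT A (fun a w => (u a * v (S w))%:E))//; last 3 first.
- by move=> k; rewrite setTI.
- move=> a; apply/measurable_EFinP; apply: measurable_funM => //.
  exact: measurableT_comp.
- by move=> a w; rewrite lee_fin mulr_ge0.
transitivity (\sum_(0 <= a <oo) \int[P]_w (u a * poisson_weight (X w) a * mv (Y w))%:E)%E.
  apply: eq_eseriesr => a _; rewrite setTI.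
  rewrite (@integral_nat_partition _ _ _ P _ S (fun b w => (u a * v b)%:E))//; last 2 first.
  - by move=> b; exact: measurableI.
  - by move=> b w; rewrite lee_fin mulr_ge0.
  transitivity (\sum_(0 <= b <oo) \int[P]_w
      (u a * poisson_weight (X w) a * (v b * poisson_weight (Y w) b))%:E)%E.
    apply: eq_eseriesr => b _.
    rewrite integral_cst//; last exact: measurableI.
    transitivity ((u a * v b)%:E * P (A @^-1` [set a] `&` S @^-1` [set b]))%E => //.
    rewrite AS -ge0_integralZl//; last 3 first.
    - by apply/measurable_EFinP; exact: measurable_funM.
    - by move=> w _; rewrite lee_fin mulr_ge0.
    - by rewrite lee_fin mulr_ge0.
    by apply: eq_integral => w _; rewrite -EFinM mulrACA.
  rewrite -integral_nneseries//; last 2 first.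
  - move=> b; apply/measurable_EFinP; apply: measurable_funM; exact: measurable_funM.
  - by move=> b w _; rewrite lee_fin !mulr_ge0.
  apply: eq_integral => w _; rewrite [RHS]EFinM -(vE _ (Y0 w)) -nneseriesZl//.
  by move=> b _; rewrite lee_fin mulr_ge0.
rewrite -integral_nneseries//; last 2 first.
- move=> a; apply/measurable_EFinP; apply: measurable_funM.
    exact: measurable_funM.
  exact: measurableT_comp.
- by move=> a w _; rewrite lee_fin !mulr_ge0.
apply: eq_integral => w _; rewrite [RHS]EFinM muleC -(uE _ (X0 w)) -nneseriesZl//.
  by apply: eq_eseriesr => a _; rewrite -EFinM mulrC.
by move=> a _; rewrite lee_fin mulr_ge0.
Qed.

End poisson_moments.

(** * Divergence of the epochs and integrals along paths *)

Section divergence.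
Context d (T : measurableType d) (R : realType) (P : probability T R).
Variables (tau : nat -> T -> R).
Hypotheses (mtau : forall n, measurable_fun setT (tau n))
  (tau_ge0 : forall n w, 0 <= tau n w).

(** A run of [k] gaps all at most [eps] has probability at most [rho ^+ k], so an infinite run is
    null. Almost surely gaps above [eps] then keep occurring, and each adds at least [eps] to the
    walk. *)
Lemma walk_dvg_of_block_bound (eps rho : R) : 0 < eps -> 0 <= rho < 1 ->
    (forall j k, (P (\bigcap_(i in [set i | (j <= i < j + k)%N])
       (tau i.+1 @^-1` `]-oo, eps])) <= (rho ^+ k)%:E)%E) ->
  {ae P, forall w, forall x, exists n, x < walk tau n w}.
Proof.
move=> eps0 /andP[rho0 rho1] bound.
(* The event that no gap after the first [j] terms of the walk exceeds [eps]. *)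
pose B j := \bigcap_(i in [set i | (j <= i)%N]) (tau i.+1 @^-1` `]-oo, eps]).
have mtau' i : measurable (tau i @^-1` `]-oo, eps]).
  by rewrite -[X in measurable X]setTI; exact: mtau.
have mB j : measurable (B j) by exact: bigcap_measurableType.
have B0 j : P (B j) = 0.
  apply/eqP; rewrite eq_le measure_ge0 andbT.
  have c : (rho ^+ k)%:E @[k --> \oo] --> 0%E.
    apply: cvg_EFin; first exact: nearW.
    by apply: cvg_expr; rewrite ger0_norm.
  rewrite -(cvg_lim _ c)//; apply: lime_ge; first by apply/cvg_ex; exists 0%E.
  apply: nearW => k; apply: le_trans (bound j k).
  apply: le_measure; rewrite ?inE//; first exact: bigcap_measurableType.
  by move=> w Bw i /= /andP[ji _]; exact: Bw.
have : {ae P, forall w, forall j, ~ B j w}.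
  apply: ae_foralln => j; exists (B j); split; [exact: mB|exact: B0|].
  by move=> w /= /contrapT.
apply: filterS => w nB x.
have later j : exists2 i, (j <= i)%N & eps < tau i.+1 w.
  apply: contrapT => H; apply: (nB j) => i /= ji; rewrite in_itv/= leNgt.
  by apply/negP => ei; apply: H; exists i.
have multiple k : exists n, k%:R * eps <= walk tau n w.
  elim: k => [|k [n kn]]; first by exists 0%N; rewrite mul0r /walk big_ord0.
  have [i ni ei] := later n; exists i.+1.
  rewrite walkS mulrSr mulrDl mul1r lerD ?(ltW ei)//.
  apply: le_trans kn _.
  exact: (@step_nondecreasing R (fun k => walk tau k w) (fun k => walk_le tau_ge0 k w)).
have [n kn] := multiple (Num.bound `|x / eps|).
exists n; apply: lt_le_trans kn; rewrite -ltr_pdivrMr//.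
exact: le_lt_trans (ler_norm _) (archi_boundP (normr_ge0 _)).
Qed.

End divergence.

Section ae_eq_integral.
Import HBNNSimple.

(* Neither function needs to be measurable: the integral of a nonnegative function
   is a supremum over simple functions, which can be set to 0 on the null set. *)
Lemma ge0_ae_eq_integralT d (T : measurableType d) (R : realType)
    (mu : {measure set T -> \bar R}) (f g : T -> \bar R) :
    (forall w, (0 <= f w)%E) -> (forall w, (0 <= g w)%E) ->
    {ae mu, forall w, f w = g w} ->
  (\int[mu]_w f w = \int[mu]_w g w)%E.
Proof.
move=> f0 g0 [N [mN N0 fgN]].
have fg w : (~` N) w -> f w = g w by move=> Nw; apply: contrapT => /fgN.
pose cut (h : {nnsfun T >-> R}) := proj_nnsfun h (measurableC mN).
have cutE h w : cut h w = if w \in N then 0 else h w.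
  by rewrite /= mindicE in_setC; case: ifP => _; rewrite ?mulr0 ?mulr1.
have int_cut h : (sintegral mu (cut h) = sintegral mu h)%E.
  rewrite -!integralT_nnsfun; apply: ge0_ae_eq_integral => //.
  - exact/measurable_EFinP.
  - exact/measurable_EFinP.
  - by move=> w _; rewrite lee_fin.
  - by move=> w _; rewrite lee_fin.
  - exists N; split => // w /=; apply: contra_notP => Nw _.
    by congr EFin; apply: (etrans (cutE h w)); rewrite memNset.
rewrite !ge0_integralTE//; apply/eqP; rewrite eq_le; apply/andP; split.
  apply: ub_ereal_sup => _ [h hf <-]; rewrite -int_cut.
  apply: ereal_sup_ubound; exists (cut h) => // w; rewrite (cutE h w).
  case: ifPn => [_|]; first exact: g0.
  by rewrite notin_setE => /fg <-; exact: hf.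
apply: ub_ereal_sup => _ [h hg <-]; rewrite -int_cut.
apply: ereal_sup_ubound; exists (cut h) => // w; rewrite (cutE h w).
case: ifPn => [_|]; first exact: f0.
by rewrite notin_setE => /fg ->; exact: hg.
Qed.

End ae_eq_integral.

Lemma lebesgue_measure_itv_inter (R : realType) (t a b : R) : 0 <= t -> 0 <= a -> a <= b ->
  (lebesgue_measure (`[0%R, t] `&` `[a, b[) = (Num.min b t - Num.min a t)%:E)%E.
Proof.
move=> t0 a0 ab; case: (leP b t) => bt.
  rewrite (_ : _ `&` _ = `[a, b[%classic); last first.
    apply/seteqP; split => s /=; rewrite !in_itv/=; first by case.
    by move=> /andP[as' sb]; rewrite as' sb (le_trans a0 as') (le_trans (ltW sb) bt).
  rewrite min_l ?(le_trans ab)// lebesgue_measure_itv/= lte_fin.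
  by case: ltP => // ba; rewrite (le_anti (introT andP (conj ab ba))) subrr.
case: (leP a t) => at'.
  rewrite (_ : _ `&` _ = `[a, t]%classic); last first.
    apply/seteqP; split => s /=; rewrite !in_itv/=.
      by move=> [/andP[_ ->] /andP[-> _]].
    move=> /andP[as' st]; rewrite as' st (le_trans a0 as').
    by rewrite (le_lt_trans st bt).
  rewrite lebesgue_measure_itv/= lte_fin.
  by case: ltP => // ta; rewrite (le_anti (introT andP (conj at' ta))) subrr.
rewrite (_ : _ `&` _ = set0) ?measure0 ?subrr//.
apply/seteqP; split => s //=; rewrite !in_itv/= => -[/andP[_ st] /andP[as' _]].
by have := lt_le_trans at' (le_trans as' st); rewrite ltxx.
Qed.

(** * Integration of the current rate along one path *)

Section path.
Context d (T : measurableType d) (R : realType).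
Variables (tau : nat -> T -> R) (w : T).
Hypotheses (tau_ge0 : forall n, 0 <= tau n w)
  (epoch_dvg : forall x, exists n, x < epoch tau n w).

Let arr n := epoch tau n w.

Lemma epoch_le n : arr n <= arr n.+1.
Proof. by rewrite /arr /epoch big_ord_recr lerDl. Qed.

Let arr_le i j : (i <= j)%N -> arr i <= arr j.
Proof. exact: step_nondecreasing epoch_le i j. Qed.

Let arr0 : arr 0 = 0. Proof. by rewrite /arr /epoch big_ord0. Qed.

(** [resampling_epoch tau n] is [arr n.+1], time 0 being [arr 0]; this shift is why the interval
    from [arr n] to [arr n.+1] carries the rates of index [n]. Coinciding epochs give an empty
    interval and do no harm. *)
Lemma resampling_count_eq s n : arr n <= s < arr n.+1 -> resampling_count tau s w = n.
Proof.
move=> /andP[ns sn]; apply: xget_unique.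
  by split => // k kn; apply: le_trans ns; exact: arr_le.
move=> k [sk ks]; case: (ltngtP k n) => // kn.
  by have := lt_le_trans sk (le_trans (arr_le kn) ns); rewrite ltxx.
by have := lt_le_trans sn (ks _ kn); rewrite ltxx.
Qed.

Lemma integral_resampled_rate (r : nat -> R) t N : 0 <= t -> (forall n, 0 <= r n) ->
    (forall n, (N <= n)%N -> occupation tau t n w = 0) ->
  \int[lebesgue_measure]_(s in `[0, t]) r (resampling_count tau s w) =
  \sum_(i < N) r i * occupation tau t i w.
Proof.
move=> t0 r0 N0.
(* The restriction to [[0, t]] provides [0 <= s], without which no interval need contain [s]. *)
have DE k : `[0, t]%classic `&` (fun s => resampling_count tau s w) @^-1` [set k] =
    `[0, t]%classic `&` `[arr k, arr k.+1[%classic.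
  apply/seteqP; split => s /=; rewrite !in_itv/= => -[/[dup] st /andP[s0 _]] sk.
    split => //; have [|n ns] := step_exists (u := arr) epoch_dvg (x := s).
      by rewrite arr0.
    by rewrite -sk (resampling_count_eq ns).
  by split => //; exact: resampling_count_eq.
have mDE k : measurable (`[0, t]%classic `&`
    (fun s => resampling_count tau s w) @^-1` [set k]).
  by rewrite DE; apply: measurableI; exact: measurable_itv.
rewrite /Rintegral.
rewrite (@integral_nat_partition _ (measurableTypeR R) R (@lebesgue_measure R) `[0, t]%classic
  (fun s => resampling_count tau s w) (fun k _ => (r k)%:E))//; last first.
  by move=> k s; rewrite lee_fin.
transitivity (fine (\sum_(0 <= k <oo) (r k * occupation tau t k w)%:E)%E).
  congr fine; apply: eq_eseriesr => k _.
  rewrite DE integral_cst//; last by apply: measurableI; exact: measurable_itv.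
  transitivity ((r k)%:E * lebesgue_measure (`[0%R, t] `&` `[arr k, arr k.+1[))%E => //.
  rewrite lebesgue_measure_itv_inter//; first by rewrite -arr0; exact: arr_le.
  exact: epoch_le.
rewrite (nneseries_split 0 N); last first.
  by move=> k _; rewrite lee_fin mulr_ge0// subr_ge0 le_min2//; exact: epoch_le.
rewrite eseries0 ?adde0; last by move=> k /= Nk _; rewrite N0 ?mulr0// -(add0n N).
by rewrite add0n big_mkord sumEFin.
Qed.

End path.

(** * The resampled rates *)

Section square_integrable.
Context d (T : measurableType d) (R : realType) (P : probability T R).

(** The variance is centred at [c], the [fine] of the expectation, hence at a real number even
    before the expectation is known to be finite. *)
Lemma sqr_integrable_of_variance (X : {RV P >-> R}) : ('V_P[X] < +oo)%E ->
  P.-integrable setT (fun w => (X w ^+ 2)%:E).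
Proof.
rewrite /variance unlock unlock; set c := fine _ => V.
have mX2 : measurable_fun setT (fun w => (X w ^+ 2)%:E).
  by apply/measurable_EFinP; exact: measurable_funX.
have mXc : measurable_fun setT (fun w => ((X w - c) ^+ 2)%:E).
  apply/measurable_EFinP; apply: measurable_funX; exact: measurable_funB.
have iXc : P.-integrable setT (fun w => ((X w - c) ^+ 2)%:E).
  apply/integrableP; split => //.
  by under eq_integral do rewrite gee0_abs ?lee_fin ?sqr_ge0//.
apply: (@le_integrable _ _ _ P _ measurableT _
  (fun w => 2%:E * ((X w - c) ^+ 2)%:E + (2 * c ^+ 2)%:E)%E) => //.
  move=> w _; rewrite -EFinM -EFinD !gee0_abs ?lee_fin ?sqr_ge0//; last first.
    by rewrite addr_ge0// mulr_ge0// sqr_ge0.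
  (* The difference between [2 * (x - c) ^+ 2 + 2 * c ^+ 2] and [x ^+ 2] is exactly
     [(x - 2 * c) ^+ 2]. *)
  have := sqr_ge0 (X w - 2 * c); nra.
apply: integrableD => //; first exact: integrableZl.
exact: finite_measure_integrable_cst.
Qed.

Lemma mul_Lfun1 (X Y : T -> R) : measurable_fun setT X -> measurable_fun setT Y ->
    P.-integrable setT (fun w => (X w ^+ 2)%:E) ->
    P.-integrable setT (fun w => (Y w ^+ 2)%:E) ->
  X * Y \in Lfun P 1.
Proof.
move=> mX mY iX iY; apply/Lfun1_integrable.
apply: (@le_integrable _ _ _ P _ measurableT _
  (fun w => (X w ^+ 2)%:E + (Y w ^+ 2)%:E)%E) => //.
- by apply/measurable_EFinP; exact: measurable_funM.
- move=> w _ /=; rewrite lee_fin normrM [leRHS]ger0_norm; last first.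
    by rewrite addr_ge0 ?sqr_ge0.
  rewrite -[X w ^+ 2]real_normK ?num_real// -[Y w ^+ 2]real_normK ?num_real//.
  have := sqr_ge0 (`|X w| - `|Y w|); have := sqr_ge0 `|X w|.
  have := sqr_ge0 `|Y w|; nra.
- exact: integrableD.
Qed.

Lemma Lfun1_of_sqr (X : T -> R) : measurable_fun setT X ->
    P.-integrable setT (fun w => (X w ^+ 2)%:E) -> X \in Lfun P 1.
Proof.
move=> mX iX; rewrite (_ : X = X * cst 1); last first.
  by apply/funext => w; rewrite -[RHS]/(X w * 1) mulr1.
apply: mul_Lfun1 => //; under eq_fun do rewrite expr1n.
exact: finite_measure_integrable_cst.
Qed.

Lemma Lfun1_of_integral (X : T -> R) (r : R) : measurable_fun setT X ->
    (forall w, 0 <= X w) -> (\int[P]_w (X w)%:E = r%:E)%E ->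
  X \in Lfun P 1.
Proof.
move=> mX X0 Xr; apply/Lfun1_integrable/integrableP; split.
  exact/measurable_EFinP.
by under eq_integral do rewrite /= ger0_norm//; rewrite Xr ltry.
Qed.

End square_integrable.

(** * Independent functionals of the intervals and of the rates *)

Section model.
Context d (T : measurableType d) (R : realType) (P : probability T R).
Variables (tau : nat -> {RV P >-> R}) (Z : nat -> {RV P >-> (R * R)%type}).
Hypothesis tau_Z_independent : mutually_independent P (intervals_and_rates tau Z).

Let F := intervals_and_rates tau Z.

Let preimage_system_measurable d' (U : measurableType d') (X : {mfun T >-> U}) :
  preimage_set_system setT X measurable `<=` (measurable : set (set T)).
Proof. by move=> _ [B mB <-]; rewrite setTI; exact: measurable_funPTI. Qed.

Let preimage_system_setI d' (U : measurableType d') (X : {mfun T >-> U}) :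
  setI_closed (preimage_set_system setT X measurable).
Proof.
move=> _ _ [B mB <-] [C mC <-]; exists (B `&` C); first exact: measurableI.
by rewrite preimage_setI !setTI.
Qed.

Let preimage_system_setT d' (U : measurableType d') (X : {mfun T >-> U}) :
  preimage_set_system setT X measurable setT.
Proof. by exists setT => //; rewrite preimage_setT setTI. Qed.

Let mF i : F i `<=` measurable.
Proof. by case: i => n; exact: preimage_system_measurable. Qed.

Let FI i : setI_closed (F i).
Proof. by case: i => n; exact: preimage_system_setI. Qed.

Let FT i : F i setT.
Proof. by case: i => n; exact: preimage_system_setT. Qed.

(* The interval lengths are nonnegative only almost surely; their positive parts
   are nonnegative everywhere. *)
Definition gap n w : R := Num.max 0 (tau n w).

Definition rate_block (J : {fset nat + nat}) := blockType F J.

Lemma measurable_gap_block J n : inl n \in J ->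
  measurable_fun setT (gap n : rate_block J -> R).
Proof.
move=> nJ.
apply: (coordinate_block FT nJ).
move=> B mB; exists (Num.max 0 @^-1` B) => //; last by rewrite setTI.
rewrite -[X in measurable X]setTI.
exact: (@measurable_maxr _ R R setT (fun=> 0) (fun x => x)).
Qed.

Lemma measurable_rate_block d' (U : measurableType d') J n (f : R * R -> U) : inr n \in J ->
  measurable_fun setT f ->
  measurable_fun setT ((fun w => f (Z n w)) : rate_block J -> U).
Proof.
move=> nJ mf.
apply: (coordinate_block FT nJ).
move=> B mB; exists (f @^-1` B) => //; last by rewrite setTI.
by rewrite -[X in measurable X]setTI; exact: mf.
Qed.

Lemma measurable_gap n : measurable_fun setT (gap n).
Proof. exact: measurable_maxr. Qed.

Lemma independent_blocks d1 d2 (U : measurableType d1) (V : measurableType d2)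
    J K (X : T -> U) (Y : T -> V) : [disjoint J & K]%fset ->
    measurable_fun setT (X : rate_block J -> U) ->
    measurable_fun setT (Y : rate_block K -> V) ->
  forall A B, measurable A -> measurable B ->
    P (X @^-1` A `&` Y @^-1` B) = (P (X @^-1` A) * P (Y @^-1` B))%E.
Proof.
move=> JK mX mY A B mA mB.
apply: (g_block_indep mF FI tau_Z_independent JK).
  by have := mX measurableT A mA; rewrite setTI.
by have := mY measurableT B mB; rewrite setTI.
Qed.

Lemma integralM_independent_blocks J K (X Y : T -> R) : [disjoint J & K]%fset ->
    measurable_fun setT (X : rate_block J -> R) ->
    measurable_fun setT (Y : rate_block K -> R) ->
    (forall w, 0 <= X w) -> (forall w, 0 <= Y w) ->
  (\int[P]_w (X w * Y w)%:E = \int[P]_w (X w)%:E * \int[P]_w (Y w)%:E)%E.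
Proof.
move=> JK mX mY X0 Y0.
have mX' := block_measurable_fun mF mX.
have mY' := block_measurable_fun mF mY.
(* Absolute values make the integrand nonnegative on the whole plane, as [integral_indep2] requires,
   and change nothing along [X] and [Y]. *)
transitivity (\int[P]_w (`|X w| * `|Y w|)%:E)%E.
  by apply: eq_integral => w _; rewrite !ger0_norm.
rewrite (@integral_indep2 _ _ _ P _ _ R R X Y (fun z => (`|z.1| * `|z.2|)%:E))//; last 2 first.
- by move=> A B; exact: (independent_blocks JK mX mY).
- apply/measurable_EFinP; apply: measurable_funM; exact: measurableT_comp.
transitivity (\int[P]_w ((\int[P]_v (Y v)%:E) * (X w)%:E))%E.
  apply: eq_integral => w _; rewrite muleC -ge0_integralZl//.
  - by apply: eq_integral => v _ /=; rewrite !ger0_norm// EFinM.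
  - exact/measurable_EFinP.
  - by move=> v _; rewrite lee_fin.
  - by rewrite lee_fin.
rewrite ge0_integralZl//.
- by rewrite muleC.
- exact/measurable_EFinP.
- by move=> v _; rewrite lee_fin.
- by apply: integral_ge0 => v _; rewrite lee_fin.
Qed.

Definition gap_indices n m : {fset nat + nat} :=
  [fset (inl i : nat + nat) | i in iota n m]%fset.

Lemma inl_gap_indices i n m : (inl i \in gap_indices n m) = (n <= i < n + m)%N.
Proof. by rewrite mem_imfset ?mem_iota//= => x y []. Qed.

Lemma inr_gap_indices i n m : inr i \notin gap_indices n m.
Proof. by apply/negP => /imfsetP[]. Qed.

Lemma gap_indices_disjoint n m n' m' : ((n + m <= n') || (n' + m' <= n))%N ->
  [disjoint gap_indices n m & gap_indices n' m']%fset.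
Proof.
move=> nm; apply/fdisjointP => -[i|i]; last by rewrite (negbTE (inr_gap_indices _ _ _)).
rewrite !inl_gap_indices; lia.
Qed.

Lemma measurable_epoch_block n m : (n <= m)%N ->
  measurable_fun setT (epoch gap n : rate_block (gap_indices 0 m) -> R).
Proof.
move=> nm; apply: measurable_sum => i; apply: measurable_gap_block.
by rewrite inl_gap_indices/= add0n (leq_trans (ltn_ord i)).
Qed.

Lemma measurable_walk_block n :
  measurable_fun setT (walk gap n : rate_block (gap_indices 1 n) -> R).
Proof.
apply: measurable_sum => i; apply: measurable_gap_block.
by rewrite inl_gap_indices/= add1n ltnS.
Qed.

(** [walk gap n] involves the gaps of index 1 to [n], hence neither gap 0 nor gap [n.+1]; similarly
    [epoch gap n.+1] stops at gap [n]. *)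
Lemma walk_gap0_independent n A B : measurable A -> measurable B ->
  P (walk gap n @^-1` A `&` gap 0 @^-1` B) =
  (P (walk gap n @^-1` A) * P (gap 0 @^-1` B))%E.
Proof.
apply: (@independent_blocks _ _ _ _ (gap_indices 1 n) (gap_indices 0 1)).
- apply: gap_indices_disjoint; lia.
- exact: measurable_walk_block.
- by apply: measurable_gap_block; rewrite inl_gap_indices.
Qed.

Lemma walk_gap_independent n A B : measurable A -> measurable B ->
  P (walk gap n @^-1` A `&` gap n.+1 @^-1` B) =
  (P (walk gap n @^-1` A) * P (gap n.+1 @^-1` B))%E.
Proof.
apply: (@independent_blocks _ _ _ _ (gap_indices 1 n) (gap_indices n.+1 1)).
- apply: gap_indices_disjoint; lia.
- exact: measurable_walk_block.
- by apply: measurable_gap_block; rewrite inl_gap_indices; lia.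
Qed.

Lemma epoch_gap_independent n A B : measurable A -> measurable B ->
  P (epoch gap n.+1 @^-1` A `&` gap n.+1 @^-1` B) =
  (P (epoch gap n.+1 @^-1` A) * P (gap n.+1 @^-1` B))%E.
Proof.
apply: (@independent_blocks _ _ _ _ (gap_indices 0 n.+1) (gap_indices n.+1 1)).
- apply: gap_indices_disjoint; lia.
- exact: measurable_epoch_block.
- by apply: measurable_gap_block; rewrite inl_gap_indices; lia.
Qed.

Lemma card_gap_indices n m : size (gap_indices n m) = m.
Proof.
rewrite -[LHS]/(#|` gap_indices n m|) card_imfset/=; last by move=> x y [].
by rewrite undup_id ?iota_uniq// size_iota.
Qed.

(** * Laws of the gaps and almost sure divergence of the epochs *)

Section laws.
Variables (xi : {RV P >-> R}).
Hypotheses (xi_ge0 : {ae P, forall w, 0 <= xi w})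
  (tau_first : has_density P (tau 0%N) (residual_density xi))
  (tau_next : forall n, identically_distributed P (tau n.+1) xi).

Let m := fine 'E_P[xi].

(** With mean 0 the residual density would vanish identically, division by 0 giving 0, and could not
    have mass one. *)
Lemma mean_gt0 : 0 < m.
Proof.
have m0 : 0 <= m.
  apply: fine_ge0; rewrite unlock.
  rewrite (_ : (\int[P]_w (xi w)%:E)%E = \int[P]_w (Num.max 0 (xi w))%:E)%E.
    by apply: integral_ge0 => w _; rewrite lee_fin le_max lexx.
  apply: ae_eq_integral => //; try exact/measurable_EFinP.
    by apply/measurable_EFinP; exact: measurable_maxr.
  by move: xi_ge0; apply: filterS => w xw _; rewrite max_r.
rewrite lt_neqAle m0 andbT; apply/negP => /eqP mE.
have [_ _ /(_ setT measurableT)] := tau_first.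
rewrite preimage_setT probability_setT integral0_eq; first by move=> /eqP; rewrite onee_eq0.
move=> x _; rewrite /residual_density -/m -mE invr0 mulr0.
by case: ifP.
Qed.

Lemma ae_not (E : set T) : measurable E -> {ae P, forall w, ~ E w} <-> P E = 0.
Proof.
move=> mE; rewrite -(negligibleP P mE).
by rewrite -[X in X <-> _]/(P.-negligible (~` ~` E)) setCK.
Qed.

Lemma tau_ge0 : {ae P, forall w, forall n, 0 <= tau n w}.
Proof.
have mN (X : {RV P >-> R}) : measurable (X @^-1` `]-oo, 0[) by exact: measurable_funPTI.
have nonneg (X : {RV P >-> R}) : P (X @^-1` `]-oo, 0[) = 0 -> {ae P, forall w, 0 <= X w}.
  move=> /(ae_not (mN X)); apply: filterS => w /=.
  by rewrite in_itv/= => /negP; rewrite -leNgt.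
apply: ae_foralln => -[|n]; apply: nonneg.
  have [_ _ ->] := tau_first; last exact: measurable_itv.
  rewrite integral0_eq// => x; rewrite /= in_itv/= => x0.
  by rewrite /residual_density leNgt x0.
rewrite tau_next; last exact: measurable_itv.
apply/(ae_not (mN xi)); move: xi_ge0; apply: filterS => w xw.
by rewrite /= in_itv/= => /lt_geF; rewrite xw.
Qed.

Lemma tail_gap x : 0 <= x -> tail P gap x = fine (ccdf xi x).
Proof.
move=> x0; rewrite /tail; congr fine.
transitivity (P (tau 1%N @^-1` `]x, +oo[)); last first.
  by apply: tau_next; exact: measurable_itv.
congr (P _); apply/seteqP; split => w /=; rewrite !in_itv/= !andbT /gap lt_max.
  by rewrite ltNge x0.
by move=> ->; rewrite orbT.
Qed.

Lemma gap_ge0 n w : 0 <= gap n w.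
Proof. by rewrite le_max lexx. Qed.

Lemma gap0_law : has_density P (gap 0) (fun x => if 0 <= x then tail P gap x / m else 0).
Proof.
have [_ _ tauE] := tau_first; split.
- apply: measurable_fun_ifT => //; first exact: measurable_fun_ler.
  by apply: measurable_funM => //; apply: measurable_tail; exact: measurable_gap.
- by move=> x; case: ifP => // _; rewrite divr_ge0 ?tail_ge0// ltW// mean_gt0.
move=> B mB.
have mB' : measurable (Num.max (0 : R) @^-1` B).
  rewrite -[X in measurable X]setTI.
  exact: (@measurable_maxr _ R R setT (fun=> 0) (fun x => x)).
rewrite [LHS](tauE _ mB') integral_mkcond [RHS]integral_mkcond.
apply: eq_integral => x _; rewrite !patchE /residual_density.
(* At negative [x] both densities are 0, so it does not matter that [B] and its preimage may differ
   there; at nonnegative [x] they agree. *)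
case: (leP 0 x) => x0; last by case: ifP; case: ifP.
suff -> : (x \in Num.max (0 : R) @^-1` B) = (x \in B) by rewrite tail_gap.
by apply/idP/idP; rewrite !inE/= max_r.
Qed.

Lemma gap_law n : identically_distributed P (gap n.+1) (gap 1).
Proof.
move=> B mB.
have mB' : measurable (Num.max (0 : R) @^-1` B).
  rewrite -[X in measurable X]setTI.
  exact: (@measurable_maxr _ R R setT (fun=> 0) (fun x => x)).
by transitivity (P (xi @^-1` (Num.max (0 : R) @^-1` B))); [|symmetry];
  exact: tau_next.
Qed.

(** Otherwise the tail would vanish on []0, +oo[] and its integral would be 0 instead of [m]. *)
Lemma tail_gt0 : exists2 e, 0 < e & 0 < tail P gap e.
Proof.
apply: contrapT => H.
have t0 e : 0 < e -> tail P gap e = 0.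
  move=> e0; apply/eqP; rewrite eq_le tail_ge0 andbT leNgt.
  by apply/negP => te; apply: H; exists e.
have := integral_tail mean_gt0 gap0_law.
rewrite -integral_itv_obnd_cbnd; last first.
  apply/measurable_EFinP; apply: measurable_funTS.
  by apply: measurable_tail; exact: measurable_gap.
rewrite integral0_eq; last first.
  by move=> x; rewrite /= in_itv/= andbT => /t0 ->.
by move=> [/eqP]; rewrite lt_eqF ?mean_gt0.
Qed.

Lemma walk_gap_dvg : {ae P, forall w, forall x, exists n, x < walk gap n w}.
Proof.
have [e e0 te] := tail_gt0.
have me n : measurable (gap n @^-1` `]-oo, e]).
  by rewrite -[X in measurable X]setTI; apply: measurable_gap.
pose rho := fine (P (gap 1 @^-1` `]-oo, e])).
have rhoE n : P (gap n.+1 @^-1` `]-oo, e]) = rho%:E.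
  by rewrite /rho fineK ?fin_num_measure//; apply: gap_law; exact: measurable_itv.
have tailE' : tail P gap e = 1 - rho.
  apply: EFin_inj; rewrite EFinB -(rhoE 0) -probability_setC//.
  rewrite /tail fineK.
    by congr (P _); rewrite preimage_setC setCitvl.
  rewrite fin_num_measure//.
  by rewrite -[X in measurable X]setTI; apply: measurable_gap.
apply: (@walk_dvg_of_block_bound _ _ _ _ _ _ _ e rho) => //.
- exact: measurable_gap.
- exact: gap_ge0.
- by rewrite fine_ge0//= -subr_gt0 -tailE'.
move=> j k.
(* The run of short gaps is indexed by [nat + nat] to match mutual independence; the value at [inr]
   is a filler, as [gap_indices] contains no such index. *)
pose E (i : nat + nat) : set T := if i is inl n then gap n @^-1` `]-oo, e] else setT.
have -> : \bigcap_(i in [set i | (j <= i < j + k)%N]) (gap i.+1 @^-1` `]-oo, e]) =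
    \bigcap_(i in [set` gap_indices j.+1 k]) E i.
  apply/seteqP; split => w Hw.
    move=> [i|i]; last by rewrite /= (negbTE (inr_gap_indices _ _ _)).
    rewrite /= inl_gap_indices; case: i => // i ji; apply: Hw => /=; lia.
  move=> i /= ji; apply: (Hw (inl i.+1)) => /=; rewrite inl_gap_indices; lia.
rewrite tau_Z_independent; last first.
  move=> [i|i]; last by rewrite (negbTE (inr_gap_indices _ _ _)).
  move=> _ /=; exists (Num.max (0 : R) @^-1` `]-oo, e]); last by rewrite setTI.
  rewrite -[X in measurable X]setTI.
  by apply: (@measurable_maxr _ R R setT (fun=> 0) (fun x => x)) => //; exact: measurable_itv.
rewrite (eq_big_seq (fun=> rho%:E)); last first.
  move=> [i|i]; last by rewrite (negbTE (inr_gap_indices _ _ _)).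
  by rewrite inl_gap_indices; case: i => // i _; exact: rhoE.
rewrite big_const_seq count_predT card_gap_indices.
elim: k => [|k IH] /=; first by rewrite expr0.
by rewrite exprS EFinM lee_wpmul2l// lee_fin fine_ge0.
Qed.

(** * Moments of the cumulative rates *)

Section rates.
Variables (Lam Mu : {RV P >-> R}) (t : R).
Hypotheses (Lam_ge0 : {ae P, forall w, 0 <= Lam w})
  (Mu_ge0 : {ae P, forall w, 0 <= Mu w})
  (Lam_variance : ('V_P[Lam] < +oo)%E) (Mu_variance : ('V_P[Mu] < +oo)%E)
  (Z_law : forall n, identically_distributed P (Z n) (fun w => (Lam w, Mu w)))
  (t_ge0 : 0 <= t).

Let ell := occupation gap t.

Definition arrival_rate n w : R := Num.max 0 (Z n w).1.
Definition service_rate n w : R := Num.max 0 (Z n w).2.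

Let max0 (x : R) : R := Num.max 0 x.

Let mmax0 : measurable_fun setT max0.
Proof. exact: (@measurable_maxr _ R R setT (fun=> 0) (fun x => x)). Qed.

Let max0_ge0 x : 0 <= max0 x.
Proof. by rewrite le_max lexx. Qed.

Lemma Z_ge0 : {ae P, forall w, forall n, 0 <= (Z n w).1 /\ 0 <= (Z n w).2}.
Proof.
pose B : set (R * R) := [set z | ~~ ((0 <= z.1) && (0 <= z.2))].
have mB : measurable B.
  rewrite (_ : B = (fun z : R * R => (0 <= z.1) && (0 <= z.2)) @^-1` [set false]); last first.
    by apply/seteqP; split => z /=; [move/negbTE|move/negbT].
  rewrite -[X in measurable X]setTI.
  by apply: measurable_and => //; exact: measurable_fun_ler.
have mLM : measurable ((fun w => (Lam w, Mu w)) @^-1` B).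
  rewrite -[X in measurable X]setTI.
  by apply: (measurable_fun_pair (f := Lam) (g := Mu)).
apply: ae_foralln => n.
have : P (Z n @^-1` B) = 0.
  rewrite Z_law//; apply/(ae_not mLM).
  by move: Lam_ge0 Mu_ge0; apply: filterS2 => w L0 M0; rewrite /B/= L0 M0.
move/(ae_not (measurable_funPTI (Z n) mB)); apply: filterS => w /= /negP.
by rewrite negbK => /andP.
Qed.

Lemma measurable_rates : (forall n, measurable_fun setT (arrival_rate n)) /\
  (forall n, measurable_fun setT (service_rate n)).
Proof.
have m1 (n : nat) : measurable_fun setT (fun w => (Z n w).1) by exact: measurableT_comp.
have m2 (n : nat) : measurable_fun setT (fun w => (Z n w).2) by exact: measurableT_comp.
by split=> n; exact: measurable_maxr.
Qed.

Lemma rates_ge0 : (forall n w, 0 <= arrival_rate n w) /\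
  (forall n w, 0 <= service_rate n w).
Proof. by split=> n w; exact: max0_ge0. Qed.

Let integral_law n (f : R * R -> R) : measurable_fun setT f -> (forall z, 0 <= f z) ->
  (\int[P]_w (f (Z n w))%:E = \int[P]_w (f (Lam w, Mu w))%:E)%E.
Proof.
move=> mf f0.
apply: (identically_distributed_integral (f := EFin \o f)) => //.
- exact: measurable_fun_pair.
- exact/measurable_EFinP.
Qed.

Let sqrL := sqr_integrable_of_variance Lam_variance.
Let sqrM := sqr_integrable_of_variance Mu_variance.
Let mL : measurable_fun setT Lam. Proof. by []. Qed.
Let mM : measurable_fun setT Mu. Proof. by []. Qed.
Let L1 := Lfun1_of_sqr mL sqrL.
Let M1 := Lfun1_of_sqr mM sqrM.
Let LM1 := mul_Lfun1 mL mM sqrL sqrM.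

Let EL := fine 'E_P[Lam].
Let EM := fine 'E_P[Mu].
Let ELM := fine 'E_P[Lam * Mu].

Lemma covariance_rates : fine (covariance P Lam Mu) = ELM - EL * EM.
Proof.
rewrite covarianceE// -(fineK (expectation_fin_num L1)).
by rewrite -(fineK (expectation_fin_num M1)) -(fineK (expectation_fin_num LM1)).
Qed.

Let integral_ae (f g : T -> R) : measurable_fun setT f -> measurable_fun setT g ->
    {ae P, forall w, f w = g w} ->
  (\int[P]_w (f w)%:E = \int[P]_w (g w)%:E)%E.
Proof.
move=> mf mg fg; apply: ae_eq_integral => //; try exact/measurable_EFinP.
by move: fg; apply: filterS => w -> _.
Qed.

Lemma integral_arrival_rate n : (\int[P]_w (arrival_rate n w)%:E = EL%:E)%E.
Proof.
rewrite (integral_law n (f := fun z => max0 z.1))//; last exact: measurableT_comp.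
rewrite /EL fineK ?expectation_fin_num// unlock; apply: integral_ae => //.
  exact: measurableT_comp.
by move: Lam_ge0; apply: filterS => w L0; rewrite /max0 max_r.
Qed.

Lemma integral_service_rate n : (\int[P]_w (service_rate n w)%:E = EM%:E)%E.
Proof.
rewrite (integral_law n (f := fun z => max0 z.2))//; last exact: measurableT_comp.
rewrite /EM fineK ?expectation_fin_num// unlock; apply: integral_ae => //.
  exact: measurableT_comp.
by move: Mu_ge0; apply: filterS => w M0; rewrite /max0 max_r.
Qed.

(** At equal indices the joint law of the pair enters, with its possible dependence; at distinct
    indices the pairs are independent. These are the coefficients [p] and [q] of the mixtures. *)
Lemma integral_rateM i j : (\int[P]_w (arrival_rate i w * service_rate j w)%:E =
  (if i == j then ELM else EL * EM)%:E)%E.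
Proof.
have [<-|ij] := eqVneq i j.
  rewrite (integral_law i (f := fun z => max0 z.1 * max0 z.2)); last 2 first.
  - by apply: measurable_funM; exact: measurableT_comp.
  - by move=> z; rewrite mulr_ge0.
  rewrite /ELM fineK ?expectation_fin_num// unlock; apply: integral_ae.
  - by apply: measurable_funM; exact: measurableT_comp.
  - exact: measurable_funM.
  - move: Lam_ge0 Mu_ge0; apply: filterS2 => w L0 M0.
    by rewrite /= /max0 !max_r.
rewrite EFinM -(integral_arrival_rate i) -(integral_service_rate j).
apply: (@integralM_independent_blocks [fset inr i]%fset [fset inr j]%fset).
- by apply/fdisjointP => x; rewrite !inE => /eqP ->; apply/eqP => -[/eqP]; rewrite (negbTE ij).
- apply: (measurable_rate_block (f := fun z => max0 z.1)); first by rewrite inE.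
  exact: measurableT_comp.
- apply: (measurable_rate_block (f := fun z => max0 z.2)); first by rewrite inE.
  exact: measurableT_comp.
- by move=> w; exact: max0_ge0.
- by move=> w; exact: max0_ge0.
Qed.

Lemma measurable_occupation_block n k : (n < k)%N ->
  measurable_fun setT (ell n : rate_block (gap_indices 0 k) -> R).
Proof.
move=> nk; apply: measurable_funB; apply: measurable_minr => //.
  exact: measurable_epoch_block nk.
exact: measurable_epoch_block (ltnW nk).
Qed.

Lemma occupation_ge0 n w : 0 <= ell n w.
Proof.
rewrite subr_ge0 le_min2//; exact: (epoch_le (w := w) (fun n => gap_ge0 n w)).
Qed.

Lemma occupation_le n w : ell n w <= t.
Proof.
rewrite lerBlDr (le_trans (y := t))// ?ge_min ?lexx ?orbT//.
by rewrite lerDl le_min t_ge0 andbT epoch_ge0// => k v; exact: gap_ge0.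
Qed.

Lemma occupation_eventually0 : {ae P, forall w, exists N,
  (forall n, (N <= n)%N -> ell n w = 0) /\ \sum_(i < N) ell i w = t}.
Proof.
move: walk_gap_dvg; apply: filterS => w dvg.
have mono := step_nondecreasing (epoch_le (w := w) (fun n => gap_ge0 n w)).
have [k tk] := dvg t.
have tN : t < epoch gap k.+1 w.
  by rewrite epochS (lt_le_trans tk)// lerDr gap_ge0.
exists k.+1; split.
  move=> n kn; rewrite /ell /occupation !min_r ?subrr//.
    by rewrite (le_trans (ltW tN))// mono.
  by rewrite (le_trans (ltW tN))// mono// (leq_trans kn).
(* The truncated epochs telescope from 0 to [t], since the last one is already beyond [t]. *)
rewrite -(big_mkord xpredT (fun i => ell i w)) /ell /occupation.
rewrite (telescope_sumr (fun i => Num.min (epoch gap i w) t))//.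
by rewrite min_r ?(ltW tN)// /epoch big_ord0 min_l// subr0.
Qed.

Let X := mixture ell arrival_rate.
Let Y := mixture ell service_rate.

Let mell n : measurable_fun setT (ell n).
Proof. by apply: measurable_occupation; exact: measurable_gap. Qed.

Lemma integral_rateM_occupationM i j :
  (\int[P]_w (arrival_rate i w * service_rate j w * (ell i w * ell j w))%:E =
   (if i == j then ELM else EL * EM)%:E * \int[P]_w (ell i w * ell j w)%:E)%E.
Proof.
rewrite -integral_rateM.
(* Both lengths depend only on the gaps up to the larger index, a block disjoint from the rates even
   when [i = j]. *)
apply: (@integralM_independent_blocks [fset inr i; inr j]%fset
  (gap_indices 0 (maxn i j).+1)).
- apply/fdisjointP => x; rewrite !inE => /orP[] /eqP ->; exact: inr_gap_indices.
- apply: measurable_funM.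
    apply: (measurable_rate_block (f := fun z => max0 z.1)); first by rewrite !inE eqxx.
    exact: measurableT_comp.
  apply: (measurable_rate_block (f := fun z => max0 z.2)); first by rewrite !inE eqxx orbT.
  exact: measurableT_comp.
- by apply: measurable_funM; apply: measurable_occupation_block; lia.
- by move=> w; rewrite mulr_ge0; [|exact: rates_ge0.1|exact: rates_ge0.2].
- by move=> w; rewrite mulr_ge0//; exact: occupation_ge0.
Qed.

Let integral_rate_occupation (f : R * R -> R) n : measurable_fun setT f ->
    (forall z, 0 <= f z) ->
  (\int[P]_w (f (Z n w) * ell n w)%:E =
   \int[P]_w (f (Z n w))%:E * \int[P]_w (ell n w)%:E)%E.
Proof.
move=> mf f0.
apply: (@integralM_independent_blocks [fset inr n]%fset (gap_indices 0 n.+1)) => //.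
- apply/fdisjointP => x; rewrite !inE => /eqP ->; exact: inr_gap_indices.
- by apply: measurable_rate_block => //; rewrite inE.
- exact: measurable_occupation_block.
- exact: occupation_ge0.
Qed.

Lemma integral_cumulative_arrival : (\int[P]_w (X w)%:E = (EL * t)%:E)%E.
Proof.
apply: integral_mixture => //.
- exact: occupation_ge0.
- exact: occupation_le.
- exact: occupation_eventually0.
- exact: measurable_rates.1.
- exact: rates_ge0.1.
- move=> n; rewrite -(integral_arrival_rate n).
  apply: (integral_rate_occupation (f := fun z => max0 z.1)) => //.
  exact: measurableT_comp.
Qed.

Lemma integral_cumulative_service : (\int[P]_w (Y w)%:E = (EM * t)%:E)%E.
Proof.
apply: integral_mixture => //.
- exact: occupation_ge0.
- exact: occupation_le.
- exact: occupation_eventually0.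
- exact: measurable_rates.2.
- exact: rates_ge0.2.
- move=> n; rewrite -(integral_service_rate n).
  apply: (integral_rate_occupation (f := fun z => max0 z.2)) => //.
  exact: measurableT_comp.
Qed.

Let W := 2 / m * (\int[lebesgue_measure]_(u in `[0, t])
      ((t * u - u ^+ 2 / 2) * fine (ccdf xi u)) +
    t ^+ 2 / 2 * \int[lebesgue_measure]_(u in `[t, +oo[) fine (ccdf xi u)).

Lemma series_occupation_sqr : (\sum_(0 <= n <oo) \int[P]_w (ell n w ^+ 2)%:E = W%:E)%E.
Proof.
rewrite (occupation_sqr_series measurable_gap gap_ge0 mean_gt0 gap0_law gap_law
  walk_gap0_independent walk_gap_independent epoch_gap_independent walk_gap_dvg t_ge0).
congr EFin; congr (_ * (_ + _ * _)); apply: eq_Rintegral => u; rewrite inE/= in_itv/=.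
  by move=> /andP[u0 _]; rewrite tail_gap.
by rewrite andbT => /(le_trans t_ge0) u0; rewrite tail_gap.
Qed.

Lemma integral_cumulativeM :
  (\int[P]_w (X w * Y w)%:E = (EL * EM * t ^+ 2 + (ELM - EL * EM) * W)%:E)%E.
Proof.
apply: integral_mixture_mul => //.
- exact: occupation_ge0.
- exact: occupation_le.
- exact: occupation_eventually0.
- exact: measurable_rates.1.
- exact: rates_ge0.1.
- exact: measurable_rates.2.
- exact: rates_ge0.2.
- exact: integral_rateM_occupationM.
- exact: series_occupation_sqr.
Qed.

(** Joins the model, written with [tau] and [Z], to the positive parts used in the computation. It
    holds on the event where all intervals and rates are nonnegative and the epochs diverge. *)
Lemma cumulative_rates : {ae P, forall w,
  \int[lebesgue_measure]_(s in `[0, t]) (current_rates tau Z s w).1 = X w /\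
  \int[lebesgue_measure]_(s in `[0, t]) (current_rates tau Z s w).2 = Y w}.
Proof.
have nonneg : {ae P, forall w, (forall n, 0 <= tau n w) /\
    (forall n, 0 <= (Z n w).1 /\ 0 <= (Z n w).2)}.
  by move: tau_ge0 Z_ge0; apply: filterS2 => w.
move: nonneg occupation_eventually0 walk_gap_dvg.
apply: filterS3 => w [tau0 Z0] [N [N0 _]] dvg.
have gapE n : gap n w = tau n w by rewrite /gap max_r.
(* The count chooses an index from a set of epochs, and this set is the same for [tau] and [gap] on
   the event considered. *)
have countE s : resampling_count tau s w = resampling_count gap s w.
  have resampling_epochE k : resampling_epoch tau k w = resampling_epoch gap k w.
    by apply: eq_bigr => i _; rewrite gapE.
  rewrite /resampling_count; congr (xget _ _); apply/seteqP; split => k /=.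
    by rewrite resampling_epochE => -[sk ks]; split => // l /ks; rewrite resampling_epochE.
  by rewrite resampling_epochE => -[sk ks]; split => // l /ks; rewrite resampling_epochE.
have epoch_dvg x : exists n, x < epoch gap n w.
  have [n xn] := dvg x; exists n.+1.
  by rewrite epochS (lt_le_trans xn)// lerDr gap_ge0.
have XE : X w = \sum_(i < N) (Z i w).1 * ell i w.
  rewrite /X (mixtureE _ N0); apply: eq_bigr => i _.
  by rewrite /arrival_rate max_r// (Z0 i).1.
have YE : Y w = \sum_(i < N) (Z i w).2 * ell i w.
  rewrite /Y (mixtureE _ N0); apply: eq_bigr => i _.
  by rewrite /service_rate max_r// (Z0 i).2.
have gap0 n : 0 <= gap n w by exact: gap_ge0.
split.
  rewrite XE -(integral_resampled_rate gap0 epoch_dvg t_ge0 (fun n => (Z0 n).1) N0).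
  by apply: eq_Rintegral => s _; rewrite /current_rates countE.
rewrite YE -(integral_resampled_rate gap0 epoch_dvg t_ge0 (fun n => (Z0 n).2) N0).
by apply: eq_Rintegral => s _; rewrite /current_rates countE.
Qed.

(** * From the cumulative rates to the counts *)

Section counts.
Variables (A S : R -> {RV P >-> nat}).
Hypothesis A_S_poisson : conditionally_independent_poisson P
    (fun s w => (current_rates tau Z s w).1)
    (fun s w => (current_rates tau Z s w).2) A S.

Let ae_eq_set (E E' : set T) : measurable E -> measurable E' ->
  {ae P, forall w, E w <-> E' w} -> P E = P E'.
Proof.
move=> mE mE' EE'.
transitivity (\int[P]_w (\1_E w)%:E)%E; first by rewrite integral_indic// setIT.
transitivity (\int[P]_w (\1_E' w)%:E)%E; last by rewrite integral_indic// setIT.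
apply: integral_ae; [exact: measurable_indic..|].
move: EE'; apply: filterS => w EE'; rewrite !indicE; congr ((nat_of_bool _)%:R).
by apply/idP/idP; rewrite !inE => /EE'.
Qed.

Let mcount (N : {RV P >-> nat}) k : measurable (N @^-1` [set k]).
Proof. exact: measurable_funPTI. Qed.

Let mincrement (N N0 : {RV P >-> nat}) k : measurable [set w | N w = (N0 w + k)%N].
Proof.
rewrite (_ : [set _ | _] = \bigcup_l (N0 @^-1` [set l] `&` N @^-1` [set (l + k)%N])).
  by apply: bigcup_measurable => l _; apply: measurableI; exact: mcount.
apply/seteqP; split => w /=; first by move=> Nw; exists (N0 w).
by move=> [l _ /= [-> ->]].
Qed.

(** The conditional law is taken on the one-step subdivision from 0 to [t] and integrated over the
    whole space; almost surely both counts start at 0, so their increments are their values. *)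
Lemma joint_count_law i j : P (A t @^-1` [set i] `&` S t @^-1` [set j]) =
  (\int[P]_w (poisson_weight (X w) i * poisson_weight (Y w) j)%:E)%E.
Proof.
have [cA cS /(_ 1 (fun n => if n is 0 then 0 else t) (fun=> i) (fun=> j))] := A_S_poisson.
move=> /(_ (lexx 0)) /(_ _) /(_ setT).
move=> H; transitivity (P ([set w | A t w = (A 0 w + i)%N] `&`
    [set w | S t w = (S 0 w + j)%N])).
  apply: ae_eq_set; [by apply: measurableI; exact: mcount|
    by apply: measurableI; exact: mincrement|].
  move: cA cS; apply: filterS2 => w [A0 _ _] [S0 _ _] /=.
  by rewrite A0 S0 !add0n.
transitivity (P (increments_are A 1 (fun n => if n is 0 then 0 else t) (fun=> i) `&`
    increments_are S 1 (fun n => if n is 0 then 0 else t) (fun=> j) `&` setT)).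
  congr (P _); rewrite setIT; congr (_ `&` _); apply/seteqP; split => w /=.
  - by move=> Aw [].
  - by move=> /(_ 0%N isT).
  - by move=> Sw [].
  - by move=> /(_ 0%N isT).
rewrite H; last 2 first.
- by case.
- by move=> M [[M0 MC _] _]; rewrite -[setT]setD0; exact: MC.
(* The left integrand contains path integrals whose measurability in [w] is unknown, hence the
   comparison free of measurability. *)
apply: ge0_ae_eq_integralT.
- move=> w; rewrite mule_ge0// /poisson_increments big_ord1 poisson_prob_set1 lee_fin;
    exact: poisson_weight_ge0.
- by move=> w; rewrite lee_fin mulr_ge0//; exact: poisson_weight_ge0.
move: cumulative_rates; apply: filterS => w [XE YE].
by rewrite /poisson_increments !big_ord1 !poisson_prob_set1 XE YE EFinM.
Qed.

Let mX : measurable_fun setT X.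
Proof.
apply: measurable_mixture => //; first exact: occupation_ge0.
  exact: measurable_rates.1.
exact: rates_ge0.1.
Qed.

Let mY : measurable_fun setT Y.
Proof.
apply: measurable_mixture => //; first exact: occupation_ge0.
  exact: measurable_rates.2.
exact: rates_ge0.2.
Qed.

Let X_ge0 w : 0 <= X w.
Proof. by apply: mixture_ge0; [exact: occupation_ge0|exact: rates_ge0.1]. Qed.

Let Y_ge0 w : 0 <= Y w.
Proof. by apply: mixture_ge0; [exact: occupation_ge0|exact: rates_ge0.2]. Qed.

Let integral_counts (u v : nat -> R) (mu mv : R -> R) :=
  @integral_mixed_poisson _ _ _ P (A t) (S t) X Y u v mu mv
  (measurable_funPT (A t)) (measurable_funPT (S t)) mX mY X_ge0 Y_ge0 joint_count_law.

Let weight1 (r : R) : (\sum_(0 <= k <oo) (1 * poisson_weight r k)%:E = 1)%E.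
Proof. by under eq_eseriesr do rewrite mul1r; exact: poisson_weight_sum. Qed.

Let mcountr (N : {RV P >-> nat}) : measurable_fun setT (fun w => (N w)%:R : R).
Proof. exact: (measurableT_comp (f := fun n : nat => n%:R : R)). Qed.

(** Given the rates the counts are independent, with means X and Y, so no Poisson variance enters
    and the covariance is that of X and Y. The terms in [t ^+ 2] cancel against the product of the
    means. *)
Lemma covariance_counts :
  covariance P (fun w => (A t w)%:R) (fun w => (S t w)%:R) =
  (fine (covariance P Lam Mu) * W)%:E.
Proof.
have IA : (\int[P]_w ((A t w)%:R : R)%:E = (EL * t)%:E)%E.
  rewrite -integral_cumulative_arrival.
  transitivity (\int[P]_w ((A t w)%:R * 1 : R)%:E)%E.
    by apply: eq_integral => w _; rewrite mulr1.
  rewrite (@integral_counts (fun k => k%:R) (fun=> 1) id (fun=> 1))//.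
    by apply: eq_integral => w _; rewrite mulr1.
  by move=> r r0; exact: poisson_weight_mean.
have IS : (\int[P]_w ((S t w)%:R : R)%:E = (EM * t)%:E)%E.
  rewrite -integral_cumulative_service.
  transitivity (\int[P]_w (1 * (S t w)%:R : R)%:E)%E.
    by apply: eq_integral => w _; rewrite mul1r.
  rewrite (@integral_counts (fun=> 1) (fun k => k%:R) (fun=> 1) id)//.
    by apply: eq_integral => w _; rewrite mul1r.
  by move=> r r0; exact: poisson_weight_mean.
have IAS : (\int[P]_w ((A t w)%:R * (S t w)%:R : R)%:E =
    (EL * EM * t ^+ 2 + (ELM - EL * EM) * W)%:E)%E.
  rewrite -integral_cumulativeM.
  by apply: (@integral_counts (fun k => k%:R) (fun k => k%:R) id id) => // r r0;
    exact: poisson_weight_mean.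
rewrite covarianceE.
- rewrite unlock IA IS IAS -EFinM -EFinB covariance_rates.
  by congr EFin; ring.
- exact: Lfun1_of_integral IA.
- exact: Lfun1_of_integral IS.
- apply: (Lfun1_of_integral _ _ IAS) => [|w]; last by rewrite mulr_ge0.
  exact: measurable_funM.
Qed.

End counts.
End rates.
End laws.
End model.

Theorem proposition4p2
  (R : realType) (d : measure_display) (T : measurableType d)
  (P : probability T R)
  (xi Lam Mu : {RV P >-> R})
  (tau : nat -> {RV P >-> R})
  (Z : nat -> {RV P >-> (R * R)%type})
  (A S : R -> {RV P >-> nat})
  (xi_ge0 : {ae P, forall w, 0 <= xi w})
  (xi_density : exists f, has_density P xi f)
  (xi_mean : ('E_P[xi] < +oo)%E)
  (xi_second_moment : ('E_P[fun w => (xi w ^+ 2)%R] < +oo)%E)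
  (Lam_ge0 : {ae P, forall w, 0 <= Lam w})
  (Mu_ge0 : {ae P, forall w, 0 <= Mu w})
  (Lam_variance : ('V_P[Lam] < +oo)%E)
  (Mu_variance : ('V_P[Mu] < +oo)%E)
  (tau_first : has_density P (tau 0%N) (residual_density xi))
  (tau_next : forall n, identically_distributed P (tau n.+1) xi)
  (Z_law : forall n, identically_distributed P (Z n) (fun w => (Lam w, Mu w)))
  (tau_Z_independent : mutually_independent P (intervals_and_rates tau Z))
  (A_S_poisson : conditionally_independent_poisson P
    (fun s w => (current_rates tau Z s w).1)
    (fun s w => (current_rates tau Z s w).2) A S)
  (t : R) (t_ge0 : 0 <= t) :
  covariance P (fun w => (A t w)%:R) (fun w => (S t w)%:R) =
  (2 * (fine (covariance P Lam Mu) / fine 'E_P[xi]) *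
   (\int[lebesgue_measure]_(u in `[0, t])
      ((t * u - u ^+ 2 / 2) * fine (ccdf xi u)) +
    t ^+ 2 / 2 * \int[lebesgue_measure]_(u in `[t, +oo[) fine (ccdf xi u)))%:E.
Proof.
rewrite (covariance_counts tau_Z_independent xi_ge0 tau_first tau_next
  Lam_ge0 Mu_ge0 Lam_variance Mu_variance Z_law t_ge0 A_S_poisson).
by congr EFin; rewrite [LHS]mulrA; congr (_ * _); rewrite mulrCA.
Qed.
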